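(* Let $(L|K,v)$ be a simple algebraic extension of valued fields which is a pure defect, branched pure or purely inertial extension in $\eta$ (where $L=K(\eta)$), and let $g$ be the minimal polynomial of $\eta$ over $K$. Take a sequence $\mathbf{Q}=\{Q_i\}_{i\in I}$ with $Q_i=x-c_i$, $c_i\in K$, such that $\{v(\eta-c_i)\}_{i\in I}$ is cofinal in $v(\eta-K)=\{v(\eta-c)\mid c\in K\}$. For each $i\in I$ put $$\alpha_i=\nu(Q_i')-\nu(Q_i)=-v(\eta-c_i),\qquad \beta_i=\nu(g')-\nu_{Q_i}(g),$$ and let $\alpha$ and $\beta$ be the smallest final segments of $\Gamma_\infty$ containing $\{\alpha_i\mid i\in I\}$ and $\{\beta_i\mid i\in I\}$, respectively. Then there is an isomorphism of $\mathcal{O}_L$-modules $$\Omega\cong I_\alpha/I_\beta .$$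
   Context: $\mathcal{O}_L,\mathcal{O}_K$ are the valuation rings of $(L,v)$ and $(K,v)$; $vL,vK$ the value groups; $Lv,Kv$ the residue fields; $\Gamma=vL$ and $\Gamma_\infty=\Gamma\cup\{\infty\}$. $\Omega=\Omega_{\mathcal{O}_L|\mathcal{O}_K}$ is the $\mathcal{O}_L$-module of Kähler differentials. For $S\subseteq\Gamma_\infty$, $I_S=\{b\in L\mid \text{there exists } s\in S \text{ with } vb\geq s\}$ (with $v0=\infty$). The valuation $\nu$ of $K[x]$ (with non-trivial support) is defined by $\nu(f)=v(f(\eta))$; $f'$ denotes the formal derivative of $f$. For a non-constant polynomial $q$ and $f\in K[x]$, with $q$-expansion $f=f_0+f_1q+\ldots+f_rq^r$, $\deg f_\ell<\deg q$, the truncation is $\nu_q(f)=\min_{0\le \ell\le r}\nu(f_\ell q^\ell)$. The members $Q_i$ of the sequence are assumed to satisfy $\nu(Q_i)<\infty$. A simple algebraic extension $(L|K,v)$, $L=K(\eta)$, which is immediate ($vL=vK$, $Lv=Kv$) is called pure immediate in $\eta$ if for every $f\in K[x]$ with $\deg f<[L:K]$ there exists $c\in K$ such that for every $b\in K$: $v(\eta-b)\ge v(\eta-c)$ implies $v(f(b))=v(f(c))$. It is unibranched if $v$ is the unique extension of $v|_K$ to $L$. The extension is a pure defect extension in $\eta$ if it is pure immediate in $\eta$ and unibranched; branched pure in $\eta$ if it is pure immediate in $\eta$ and not unibranched. It is purely inertial if $Lv|Kv$ is simple and $[L:K]=[Lv:Kv]$; it is purely inertial in $\eta$ if moreover $\eta\in\mathcal{O}_L$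 is such that its residue $\eta v$ generates $Lv$ over $Kv$ (such $\eta$ generates $L$ over $K$). *)

(* Defs.v *)
From HB Require Import structures.
From mathcomp Require Import all_boot all_order all_algebra all_field.
From mathcomp Require Import boolp classical_sets.
From mathcomp.multinomials Require Import freeg.

Set Implicit Arguments.
Unset Strict Implicit.
Unset Printing Implicit Defensive.

Import Order.TTheory GRing.Theory.

Local Open Scope ring_scope.
Local Open Scope quotient_scope.

(* [porderZmodType] relates the order to neither totality nor addition. *)
Record orderedAbelianType := OrderedAbelianType {
  oag_base : porderZmodType;
  oag_total : total (<=%O : rel oag_base);
  oag_leD2r_subproof : forall x y z : oag_base, x <= y -> x + z <= y + z
}.

Definition oag_sort (G : orderedAbelianType) : Type := oag_base G.
Coercion oag_sort : orderedAbelianType >-> Sortclass.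

HB.instance Definition _ (G : orderedAbelianType) :=
  Num.POrderedZmodule.copy (oag_sort G) (oag_base G).
HB.instance Definition _ (G : orderedAbelianType) :=
  Order.POrder_isTotal.Build ring_display (oag_sort G) (@oag_total G).

Lemma oag_leD2r (G : orderedAbelianType) (x y z : G) :
  x <= y -> x + z <= y + z.
Proof. exact: oag_leD2r_subproof. Qed.

(* [None] is the element infinity. *)
Definition with_infty (G : Type) : Type := option G.

Definition fin (G : Type) (x : G) : with_infty G := Some x.
Definition infty {G : Type} : with_infty G := None.

Section WithInfty.
Variable G : orderedAbelianType.
Implicit Types x y z : with_infty G.

HB.instance Definition _ := Choice.copy (with_infty G) (option G).

Definition le_infty x y : bool :=
  match x, y with
  | _, None => true
  | None, Some _ => false
  | Some a, Some b => a <= b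
  end.

Fact le_infty_refl : reflexive le_infty.
Proof. by case=> /=. Qed.

Fact le_infty_anti : antisymmetric le_infty.
Proof. by case=> [a|] [b|] //= /le_anti ->. Qed.

Fact le_infty_trans : transitive le_infty.
Proof. by case=> [a|] [b|] [c|] //=; apply: le_trans. Qed.

HB.instance Definition _ := Order.Le_isPOrder.Build ring_display (with_infty G)
  le_infty_refl le_infty_anti le_infty_trans.

Fact le_infty_total : total (<=%O : rel (with_infty G)).
Proof. by case=> [a|] [b|] //=; exact: le_total. Qed.

HB.instance Definition _ :=
  Order.POrder_isTotal.Build ring_display (with_infty G) le_infty_total.

Fact lex_infty x : x <= (infty : with_infty G).
Proof. by case: x. Qed.

HB.instance Definition _ :=
  Order.hasTop.Build ring_display (with_infty G) lex_infty.

Definition add_infty x y : with_infty G :=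
  match x, y with
  | Some a, Some b => fin (a + b)
  | _, _ => infty
  end.

(* Only meaningful for a finite subtrahend: the value at [y = infty] is junk. *)
Definition sub_infty x y : with_infty G :=
  match x, y with
  | Some a, Some b => fin (a - b)
  | _, _ => infty
  end.

Lemma le_fin (a b : G) : (fin a <= fin b) = (a <= b).
Proof. by []. Qed.

Lemma lt_fin (a b : G) : (fin a < fin b) = (a < b).
Proof. by rewrite !lt_neqAle le_fin. Qed.

End WithInfty.

Record valuation (L : fieldType) (G : orderedAbelianType) := Valuation {
  valuation_fun :> L -> with_infty G;
  val_eq_infty : forall x, (valuation_fun x == infty) = (x == 0);
  val_mul : forall x y,
    valuation_fun (x * y) = add_infty (valuation_fun x) (valuation_fun y);
  val_add : forall x y,
    Order.min (valuation_fun x) (valuation_fun y) <= valuation_fun (x + y)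
}.

Section ValuationTheory.
Variables (L : fieldType) (G : orderedAbelianType) (v : valuation L G).
Implicit Types x y : L.

Lemma val0 : v 0 = infty.
Proof. by apply/eqP; rewrite val_eq_infty. Qed.

Lemma val1 : v 1 = fin 0.
Proof.
have := val_mul v 1 1; rewrite mulr1.
have := val_eq_infty v 1; rewrite oner_eq0.
case: (v 1) => [a|//] _ [] /eqP.
by rewrite -{1}[a]addr0 (inj_eq (addrI a)) => /eqP <-.
Qed.

Lemma valN1 : v (-1) = fin 0.
Proof.
have := val_mul v (-1) (-1); rewrite mulrNN mulr1 val1.
case: (v (-1)) => [a|//] [] a2; congr Some; apply/eqP.
rewrite eq_le; apply/andP; split; rewrite leNgt; apply/negP => a0.
  by have := oag_leD2r a (ltW a0); rewrite -a2 add0r leNgt a0.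
by have := oag_leD2r a (ltW a0); rewrite -a2 add0r leNgt a0.
Qed.

Lemma valN x : v (- x) = v x.
Proof.
by rewrite -mulN1r val_mul valN1; case: (v x) => //= a; rewrite add0r.
Qed.

Lemma val_subring_ge x y t : t <= v x -> t <= v y -> t <= v (x - y).
Proof.
move=> tx ty; apply: le_trans (val_add v x (- y)).
by rewrite valN le_min tx ty.
Qed.

Lemma val_sub_gt x y t : t < v x -> t < v y -> t < v (x - y).
Proof.
move=> tx ty; apply: lt_le_trans (val_add v x (- y)).
by rewrite valN lt_min tx ty.
Qed.

Lemma add_infty_ge0 (s t : with_infty G) :
  fin 0 <= s -> fin 0 <= t -> fin 0 <= add_infty s t.
Proof.
case: s => [a|//]; case: t => [b|//]; rewrite !le_fin => a0 b0.
by apply: (le_trans b0); rewrite -{1}[b]add0r; apply: oag_leD2r.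
Qed.

Lemma add_infty_gt0 (s t : with_infty G) :
  fin 0 <= s -> fin 0 < t -> fin 0 < add_infty s t.
Proof.
case: s => [a|//]; case: t => [b|//]; rewrite le_fin !lt_fin => a0 b0.
by apply: (lt_le_trans b0); rewrite -{1}[b]add0r; apply: oag_leD2r.
Qed.

Definition valring_pred : {pred L} := [pred x | fin 0 <= v x].

Fact valring_subring : subring_closed valring_pred.
Proof.
split=> [|x y|x y]; rewrite !inE ?val1 //; first exact: val_subring_ge.
by rewrite val_mul; apply: add_infty_ge0.
Qed.

HB.instance Definition _ := GRing.isSubringClosed.Build L valring_pred
  valring_subring.

Definition valring : Type := {x : L | x \in valring_pred}.

HB.instance Definition _ := SubChoice.on valring.
HB.instance Definition _ := [SubChoice_isSubComNzRing of valring by <:].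

Definition valring_val : valring -> L := val.

Fact valring_val_zmod : zmod_morphism valring_val.
Proof. exact: raddfB. Qed.
Fact valring_val_monoid : monoid_morphism valring_val.
Proof. by split; [exact: rmorph1 | exact: rmorphM]. Qed.

HB.instance Definition _ := GRing.isZmodMorphism.Build valring L valring_val
  valring_val_zmod.
HB.instance Definition _ := GRing.isMonoidMorphism.Build valring L valring_val
  valring_val_monoid.

Definition maxideal : {pred valring} := [pred x | fin 0 < v (val x)].

Fact maxideal_ideal : idealr_closed maxideal.
Proof.
split=> [||a x y]; rewrite !inE ?rmorph0 ?rmorph1 ?val0 ?val1 ?ltxx //.
move=> x0 y0; rewrite rmorphD rmorphM /= -[val y]opprK.
apply: val_sub_gt; last by rewrite valN.
by rewrite val_mul; apply: add_infty_gt0 => //; exact: (valP a).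
Qed.

HB.instance Definition _ := isIdealr.Build valring maxideal maxideal_ideal.

Definition resfield : Type := {ideal_quot maxideal}.

HB.instance Definition _ := GRing.ComNzRing.on resfield.

Definition residue (x : valring) : resfield := \pi_({ideal_quot maxideal}) x.

Lemma residue_eq (x y : valring) : (residue x == residue y) = (x - y \in maxideal).
Proof. by rewrite Quotient.idealrBE. Qed.

Fact residue_zmod : zmod_morphism residue.
Proof. exact: raddfB. Qed.
Fact residue_monoid : monoid_morphism residue.
Proof. by split; [exact: rmorph1 | exact: rmorphM]. Qed.

HB.instance Definition _ := GRing.isZmodMorphism.Build valring resfield residue
  residue_zmod.
HB.instance Definition _ := GRing.isMonoidMorphism.Build valring resfield residue
  residue_monoid.

Definition resfield_repr (x : resfield) : valring :=
  repr (x : {ideal_quot maxideal}).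

Lemma resfield_reprK : cancel resfield_repr residue.
Proof. exact: reprK. Qed.

Definition resfield_inv (x : resfield) : resfield :=
  if x == 0 then 0 else residue (insubd 0 (val (resfield_repr x))^-1).

Fact resfield_mulVf (x : resfield) : x != 0 -> resfield_inv x * x = 1.
Proof.
move=> x0; rewrite /resfield_inv (negPf x0) -{2}[x]resfield_reprK.
move: x0; rewrite -{1}[x]resfield_reprK -(rmorph0 residue) residue_eq subr0.
set y := resfield_repr x; rewrite inE => y0.
have vy : v (val y) = fin 0.
  by apply/eqP; rewrite eq_le leNgt y0; exact: (valP y).
have yn0 : val y != 0 by rewrite -(val_eq_infty v) vy.
have vy' : v (val y)^-1 = fin 0.
  have := val_mul v (val y) (val y)^-1; rewrite divff // val1 vy.
  by case: (v _^-1) => [a|//] [] ->; rewrite add0r.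
rewrite -rmorphM -[1](rmorph1 residue); congr residue; apply: val_inj.
by rewrite rmorphM rmorph1 /= val_insubd inE vy' lexx mulVf.
Qed.

Fact resfield_inv0 : resfield_inv 0 = 0.
Proof. by rewrite /resfield_inv eqxx. Qed.

HB.instance Definition _ := GRing.ComNzRing_isField.Build resfield
  resfield_mulVf resfield_inv0.

Definition value_group : set G := [set t | exists x, v x = fin t]%classic.

End ValuationTheory.

Arguments valring_val {L G} v.

Section Restriction.
Variables (K : fieldType) (L : fieldExtType K) (G : orderedAbelianType).
Variable v : valuation L G.

Definition restrict_fun (a : K) : with_infty G := v a%:A.

Fact restrict_eq_infty a : (restrict_fun a == infty) = (a == 0).
Proof. by rewrite val_eq_infty (fmorph_eq0 (in_alg L)). Qed.
Fact restrict_mul a b :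
  restrict_fun (a * b) = add_infty (restrict_fun a) (restrict_fun b).
Proof. by rewrite -val_mul; congr (v _); apply: (rmorphM (in_alg L)). Qed.
Fact restrict_add a b :
  Order.min (restrict_fun a) (restrict_fun b) <= restrict_fun (a + b).
Proof. by have := val_add v a%:A b%:A; rewrite -(rmorphD (in_alg L)). Qed.

Definition restrict : valuation K G :=
  Valuation restrict_eq_infty restrict_mul restrict_add.

Fact valring_map_subproof (a : valring restrict) :
  (val a)%:A \in valring_pred v.
Proof. exact: (valP a). Qed.

Definition valring_map (a : valring restrict) : valring v :=
  Sub (val a)%:A (valring_map_subproof a).

Fact valring_map_zmod : zmod_morphism valring_map.
Proof.
by move=> a b; apply: val_inj; apply: (rmorphB (in_alg L)).
Qed.
Fact valring_map_monoid : monoid_morphism valring_map.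
Proof.
split=> [|a b]; apply: val_inj; first exact: (rmorph1 (in_alg L)).
exact: (rmorphM (in_alg L)).
Qed.

HB.instance Definition _ := GRing.isZmodMorphism.Build
  (valring restrict) (valring v) valring_map valring_map_zmod.
HB.instance Definition _ := GRing.isMonoidMorphism.Build
  (valring restrict) (valring v) valring_map valring_map_monoid.

Definition resfield_map (x : resfield restrict) : resfield v :=
  residue (valring_map (resfield_repr x)).

Lemma resfield_mapE (a : valring restrict) :
  resfield_map (residue a) = residue (valring_map a).
Proof.
apply/eqP; rewrite residue_eq -rmorphB inE /=.
have := residue_eq (resfield_repr (residue a)) a.
by rewrite resfield_reprK eqxx inE => /esym.
Qed.

Fact resfield_map_zmod : zmod_morphism resfield_map.
Proof.
move=> x y; rewrite -[x]resfield_reprK -[y]resfield_reprK.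
rewrite -(rmorphB (@residue K G restrict)) !resfield_mapE.
by rewrite (rmorphB valring_map) (rmorphB (@residue L G v)).
Qed.
Fact resfield_map_monoid : monoid_morphism resfield_map.
Proof.
split=> [|x y].
  by rewrite -(rmorph1 (@residue K G restrict)) resfield_mapE !rmorph1.
rewrite -[x]resfield_reprK -[y]resfield_reprK.
rewrite -(rmorphM (@residue K G restrict)) !resfield_mapE.
by rewrite (rmorphM valring_map) (rmorphM (@residue L G v)).
Qed.

HB.instance Definition _ := GRing.isZmodMorphism.Build
  (resfield restrict) (resfield v) resfield_map resfield_map_zmod.
HB.instance Definition _ := GRing.isMonoidMorphism.Build
  (resfield restrict) (resfield v) resfield_map resfield_map_monoid.

End Restriction.

Arguments valring_map {K L G} v.
Arguments resfield_map {K L G} v.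

(* [restr phi] is [B] seen as an [A]-module through [phi : A -> B]. *)

Section RestrictScalars.
Variables (A B : nzRingType) (phi : {rmorphism A -> B}).

Definition restr of {rmorphism A -> B} : Type := B.
Local Notation M := (restr phi).

HB.instance Definition _ := GRing.Zmodule.on M.

Definition restr_scale (a : A) (x : M) : M := phi a * (x : B).

Fact restr_scaleA a b x : restr_scale a (restr_scale b x) = restr_scale (a * b) x.
Proof. by rewrite /restr_scale rmorphM mulrA. Qed.
Fact restr_scale1 : left_id 1 restr_scale.
Proof. by move=> x; rewrite /restr_scale rmorph1 mul1r. Qed.
Fact restr_scaleDr : right_distributive restr_scale +%R.
Proof. by move=> a x y; rewrite /restr_scale mulrDr. Qed.
Fact restr_scaleDl x : {morph restr_scale^~ x : a b / a + b}.
Proof. by move=> a b; rewrite /restr_scale rmorphD mulrDl. Qed.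

HB.instance Definition _ := GRing.Zmodule_isLmodule.Build A M
  restr_scaleA restr_scale1 restr_scaleDr restr_scaleDl.

End RestrictScalars.

Section Quotients.
Variables (R : nzRingType) (M : lmodType R).

Definition submodule_of (N : submodClosed M) : Type := {x : M | x \in N}.

HB.instance Definition _ N := SubChoice.on (submodule_of N).
HB.instance Definition _ N :=
  GRing.SubChoice_isSubLmodule.Build R M _ (submodule_of N)
    (GRing.subsemimodClosedP N).

(* [submodClosed] does not register closure under opposite, which the
   library's quotient asks for. *)
Definition submodule_pred (N : submodClosed M) : {pred M} := fun x => x \in N.

Fact submodule_pred_closed N : submod_closed (submodule_pred N).
Proof.
exact: (GRing.subsemimod_closed_submod (GRing.subsemimodClosedP N)).
Qed.

HB.instance Definition _ N :=
  GRing.isZmodClosed.Build M (submodule_pred N)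
    (GRing.submod_closedB (submodule_pred_closed N)).

Variable N : submodClosed M.

Definition quotmod : Type := Quotient.quot (submodule_pred N).

HB.instance Definition _ := GRing.Zmodule.on quotmod.

Definition quotmod_pi (x : M) : quotmod := \pi_(Quotient.quot (submodule_pred N)) x.
Definition quotmod_repr (x : quotmod) : M :=
  repr (x : Quotient.quot (submodule_pred N)).

Lemma quotmod_reprK : cancel quotmod_repr quotmod_pi.
Proof. exact: reprK. Qed.

Lemma quotmod_eq (x y : M) : (quotmod_pi x == quotmod_pi y) = (x - y \in N).
Proof. exact: (esym (Quotient.idealrBE (submodule_pred N) x y)). Qed.

Fact quotmod_pi_zmod : zmod_morphism quotmod_pi.
Proof. exact: raddfB. Qed.

HB.instance Definition _ :=
  GRing.isZmodMorphism.Build M quotmod quotmod_pi quotmod_pi_zmod.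

Definition quotmod_scale (a : R) (x : quotmod) : quotmod :=
  quotmod_pi (a *: quotmod_repr x).

Fact quotmod_pi_scale a x : quotmod_pi (a *: x) = quotmod_scale a (quotmod_pi x).
Proof.
apply/eqP; rewrite quotmod_eq -scalerBr rpredZ //.
by rewrite -quotmod_eq quotmod_reprK.
Qed.

Fact quotmod_scaleA a b x :
  quotmod_scale a (quotmod_scale b x) = quotmod_scale (a * b) x.
Proof. by rewrite -[x]quotmod_reprK -!quotmod_pi_scale scalerA. Qed.
Fact quotmod_scale1 : left_id 1 quotmod_scale.
Proof.
by move=> x; rewrite -[x]quotmod_reprK -quotmod_pi_scale scale1r.
Qed.
Fact quotmod_scaleDr : right_distributive quotmod_scale +%R.
Proof.
move=> a x y; rewrite -[x]quotmod_reprK -[y]quotmod_reprK -raddfD.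
by rewrite -!quotmod_pi_scale scalerDr raddfD.
Qed.
Fact quotmod_scaleDl x : {morph quotmod_scale^~ x : a b / a + b}.
Proof.
by move=> a b; rewrite -[x]quotmod_reprK -!quotmod_pi_scale scalerDl raddfD.
Qed.

HB.instance Definition _ := GRing.Zmodule_isLmodule.Build R quotmod
  quotmod_scaleA quotmod_scale1 quotmod_scaleDr quotmod_scaleDl.

HB.instance Definition _ :=
  GRing.isScalable.Build R M quotmod *:%R quotmod_pi quotmod_pi_scale.

End Quotients.

(* [subquot A B] is [A / (A :&: B)], i.e. [A / B] when [B] is contained
    in [A]. *)

Section Subquotient.
Variables (R : nzRingType) (M : lmodType R) (A B : submodClosed M).

Definition sub_in : {pred submodule_of A} := fun x => val x \in B.

Fact sub_in_closed : submod_closed sub_in.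
Proof.
have inE x : (x \in sub_in) = (val x \in B) by [].
split=> [|a x y]; rewrite !inE; first exact: rpred0.
move=> xB yB.
have -> : val (a *: x + y) = a *: val x + val y by exact: GRing.linearP.
by rewrite rpredD ?rpredZ.
Qed.

HB.instance Definition _ :=
  GRing.isSubmodClosed.Build R (submodule_of A) sub_in sub_in_closed.

Definition subquot : Type := quotmod sub_in.

HB.instance Definition _ := GRing.Lmodule.on subquot.

End Subquotient.

Section Span.
Variables (R : nzRingType) (M : lmodType R) (X : set M).

Definition span_mod : {pred M} :=
  fun x => `[< forall N : submodClosed M, (forall y, X y -> y \in N) -> x \in N >].

Fact span_mod_closed : submod_closed span_mod.
Proof.
split=> [|a x y]; rewrite !unfold_in; first by apply/asboolP=> N _; exact: rpred0.
move=> /asboolP xX /asboolP yX; apply/asboolP => N XN.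
by rewrite rpredD ?rpredZ ?xX ?yX.
Qed.

HB.instance Definition _ := GRing.isSubmodClosed.Build R M span_mod
  span_mod_closed.

End Span.

Definition lmod_isomorphic (R : nzRingType) (U V : lmodType R) : Prop :=
  exists f : {linear U -> V}, bijective f.

(* Omega_{B|A}, presented by generators [d x], [x : B], and relations. *)
Section Kaehler.
Variables (A B : comNzRingType) (phi : {rmorphism A -> B}).

Local Notation d x := (<< 1 *g x >> : {freeg B / B}).

Definition kaehler_rel : set {freeg B / B} := [set r |
  [\/ exists x y, r = d (x + y) - d x - d y,
      exists x y, r = d (x * y) - x *: d y - y *: d x
    | exists a, r = d (phi a)]]%classic.

Definition kaehler : Type := quotmod (span_mod kaehler_rel).

HB.instance Definition _ := GRing.Lmodule.on kaehler.

End Kaehler.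

Section Extensions.
Variables (K : fieldType) (L : fieldExtType K) (G : orderedAbelianType).
Variable v : valuation L G.
Local Notation vK := (restrict v).

Definition immediate : Prop :=
  value_group v = value_group vK
  /\ (forall y : resfield v, exists x : resfield vK, resfield_map v x = y).

Definition pure_immediate (eta : L) : Prop :=
  [/\ <<1; eta>>%VS = fullv, immediate &
      forall f : {poly K}, (size f <= \dim {:L})%N ->
      exists c : K, forall b : K,
        v (eta - c%:A) <= v (eta - b%:A) -> vK f.[b] = vK f.[c]].

(* Valuations are identified when they have the same valuation ring. *)
Definition unibranched : Prop :=
  forall (G' : orderedAbelianType) (w : valuation L G'),
    valring_pred (restrict w) =i valring_pred vK ->
    valring_pred w =i valring_pred v.

Definition pure_defect (eta : L) : Prop := pure_immediate eta /\ unibranched.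

Definition branched_pure (eta : L) : Prop :=
  pure_immediate eta /\ ~ unibranched.

Definition resfield_generator (z : resfield v) : Prop :=
  forall F : {pred resfield v}, divring_closed F ->
    (forall x : resfield vK, resfield_map v x \in F) -> z \in F ->
    forall y, y \in F.

Definition resfield_degree (n : nat) : Prop :=
  inhabited (Vector.axiom n (restr (resfield_map v))).

Definition purely_inertial : Prop :=
  (exists z, resfield_generator z) /\ resfield_degree (\dim {:L}).

Definition purely_inertial_in (eta : L) : Prop :=
  purely_inertial /\
  exists2 x : valring v, val x = eta & resfield_generator (residue x).

End Extensions.

Section Truncation.
Variables (K : fieldType) (L : fieldExtType K) (G : orderedAbelianType).
Variables (v : valuation L G) (eta : L).

Definition nu (f : {poly K}) : with_infty G := v (horner_alg eta f).

Definition qcoef (q f : {poly K}) (l : nat) : {poly K} := (f %/ q ^+ l) %% q.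

Lemma size_qcoef (q f : {poly K}) l : (1 < size q)%N -> (size (qcoef q f l) < size q)%N.
Proof. by move=> q1; rewrite ltn_modp -size_poly_gt0 ltnW. Qed.

Lemma qexpansion (q f : {poly K}) : (1 < size q)%N ->
  f = \sum_(l < size f) qcoef q f l * q ^+ l.
Proof.
move=> q1; have q0 : q != 0 by rewrite -size_poly_gt0 ltnW.
have E n : f = \sum_(l < n) qcoef q f l * q ^+ l + (f %/ q ^+ n) * q ^+ n.
  elim: n => [|n IHn]; first by rewrite big_ord0 add0r expr0 divp1 mulr1.
  rewrite {1}IHn big_ord_recr /= -addrA; congr (_ + _).
  rewrite {1}(divp_eq (f %/ q ^+ n) q) mulrDl addrC; congr (_ + _).
  by rewrite divp_divl -exprSr exprS mulrA.
rewrite {1}(E (size f)) divp_small ?mul0r ?addr0 //.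
have [->|f0] := eqVneq f 0; first by rewrite size_poly0 expr0 size_poly1.
have qf : (size f <= (size q).-1 * size f)%N by rewrite leq_pmull // -ltnS prednK // ltnW.
rewrite -(prednK (n := size (q ^+ _))) ?size_poly_gt0 ?expf_neq0 //.
by rewrite size_exp ltnS.
Qed.

(* [size f] bounds the length of the expansion of [f] when [q] is not constant;
   the terms beyond its end vanish and have value infinity. *)
Definition nu_trunc (q f : {poly K}) : with_infty G :=
  \big[Order.min/infty]_(l < size f) nu (qcoef q f l * q ^+ l).

End Truncation.

Definition final_segment (G : orderedAbelianType) (T : set (with_infty G)) :=
  forall s t, T s -> s <= t -> T t.

Definition final_closure (G : orderedAbelianType) (S : set (with_infty G)) :=
  smallest (@final_segment G) S.

Definition cofinal_in (G : orderedAbelianType) (S T : set (with_infty G)) :=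
  (S `<=` T)%classic /\ forall t, T t -> exists2 s, S s & t <= s.

Definition IS (L : fieldType) (G : orderedAbelianType) (v : valuation L G)
    (S : set (with_infty G)) : set L :=
  [set b | exists2 s, S s & s <= v b]%classic.

(* Main.v *)
From HB Require Import structures.
Require Import Defs.
From mathcomp Require Import all_boot all_order all_algebra all_field.
From mathcomp Require Import boolp classical_sets.
From mathcomp.multinomials Require Import freeg.

Set Implicit Arguments.
Unset Strict Implicit.
Unset Printing Implicit Defensive.

Import Order.TTheory GRing.Theory.

Local Open Scope ring_scope.
Local Open Scope classical_set_scope.

(** The forms are computed on a chain of monogenic subrings of the valuation
    ring.  Choose [d i] in [K] with the same value as [eta - c i] and put
    [u i = (eta - c i) / d i], a unit of the valuation ring of [L].  If
    [v (eta - c i) <= v (eta - c k)], then [u i] is an affine function of [u k]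
    with integral coefficients, so the rings O_K[u i] form a chain.

    Write [g (d i * X + c i) = r i * P i] with [P i] primitive.  By Gauss's
    lemma [P i] generates the kernel of O_K[X] -> O_K[u i], so the differentials
    of O_K[u i] are generated by [d u_i] with the single relation
    [P_i'(u_i) d u_i = 0].  The assignment [d u_i |-> 1 / d i] (that is,
    [d eta |-> 1]) is compatible with the chain.  Hence, if the chain exhausts
    the valuation ring, its module of differentials is the quotient of the
    union of the [O_L / d i] by the union of the [O_L * P_i'(u_i) / d i]; this
    is [kaehler_directed].  Now [P_i'(u_i) / d i = g'(eta) / r i], and [v (r i)]
    is the least value of a coefficient of [g (d i * X + c i)], which is the
    truncation of [nu] at [X - c i] applied to [g]; so the two unions are the
    submodules I_alpha and I_beta of [L] ([kaehler_of_levels]).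

    It remains to see that the chain is exhausting.

    In the pure immediate cases an element of the valuation ring is [f (eta)]
    with [f] of degree less than [L : K].  The values [v (eta - c i)] have no
    maximum, and [v (f (c i))] is eventually constant.  Newton interpolation at
    the points [c i] shows that a polynomial whose values at these points are
    eventually integral becomes integral in the variable [(X - c j) / d j] for
    some [j] ([integral_of_values]); and the constant value of the [f (c i)]
    cannot be negative, since it would then be the value of [f (eta)]
    ([horner_unit]).

    In the purely inertial case the powers of the residue of [eta] below the
    degree are linearly independent over the residue field of [K], so the value
    of [f (eta)] is the least value of a coefficient of [f]; thus the valuation
    ring is already O_K[eta] ([inertial_val]). *)

(** * Kähler differentials by generators and relations *)

Section KaehlerTheory.
Variables (A B : comNzRingType) (phi : {rmorphism A -> B}).
Local Notation Omega := (kaehler phi).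

Definition kaehler_d (x : B) : Omega :=
  quotmod_pi (span_mod (kaehler_rel phi)) << 1 *g x >>.
Local Notation d := kaehler_d.

Lemma quotmod_pi_eq0 (R : nzRingType) (M : lmodType R) (N : submodClosed M) x :
  x \in N -> quotmod_pi N x = 0.
Proof.
by move=> xN; apply/eqP; rewrite -(raddf0 (quotmod_pi N)) quotmod_eq subr0.
Qed.

Lemma kaehler_rel0 r : kaehler_rel phi r ->
  quotmod_pi (span_mod (kaehler_rel phi)) r = 0.
Proof.
move=> rr; apply: quotmod_pi_eq0.
by rewrite unfold_in; apply/asboolP => N; apply.
Qed.

Lemma kaehler_dD x y : d (x + y) = d x + d y.
Proof.
apply/eqP; rewrite -subr_eq0 opprD addrA -!raddfB; apply/eqP.
by apply: kaehler_rel0; apply: Or31; exists x, y.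
Qed.

Lemma kaehler_dM x y : d (x * y) = x *: d y + y *: d x.
Proof.
apply/eqP; rewrite -subr_eq0 opprD addrA -!linearZ -!raddfB; apply/eqP.
by apply: kaehler_rel0; apply: Or32; exists x, y.
Qed.

Lemma kaehler_d_base a : d (phi a) = 0.
Proof. by apply: kaehler_rel0; apply: Or33; exists a. Qed.

(** The chain rule: over [A] the coefficients of [F] have differential 0. *)
Lemma kaehler_d_horner (F : {poly A}) (u : B) :
  d (map_poly phi F).[u] = (map_poly phi F^`()).[u] *: d u.
Proof.
elim/poly_ind: F => [|F a IH].
  rewrite linear0 !raddf0 !horner0 scale0r.
  by rewrite -[0](rmorph0 phi) kaehler_d_base.
rewrite derivD derivC addr0 derivM derivX mulr1.
rewrite !(rmorphD, rmorphM) /= map_polyX map_polyC /= !hornerE.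
rewrite kaehler_dD kaehler_d_base addr0 kaehler_dM IH.
by rewrite scalerDl scalerA addrC mulrC [_.[u] * u]mulrC addrC.
Qed.

Lemma freeg_scaleU (k b x : B) :
  k *: << b *g x >> = << k * b *g x >> :> {freeg B / B}.
Proof. by apply/eqP/freeg_eqP => y; rewrite coeffZ !coeffU mulrA. Qed.

Lemma freeg_gen_ind (P : {freeg B / B} -> Prop) :
    P 0 -> (forall r1 r2, P r1 -> P r2 -> P (r1 + r2)) ->
    (forall b x, P << b *g x >>) ->
  forall r, P r.
Proof. by move=> P0 PD PU r; rewrite -[r]freeg_sumE; apply: big_ind. Qed.

Lemma kaehler_ind (P : Omega -> Prop) :
    P 0 -> (forall w1 w2, P w1 -> P w2 -> P (w1 + w2)) ->
    (forall b x, P (b *: d x)) ->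
  forall w, P w.
Proof.
move=> P0 PD PZ w; rewrite -[w]quotmod_reprK.
elim/freeg_gen_ind: (quotmod_repr w) => [|r1 r2|b x].
- by rewrite raddf0.
- by rewrite raddfD; apply: PD.
- by have := PZ b x; rewrite /d -[_ *: _]quotmod_pi_scale freeg_scaleU mulr1.
Qed.

Section Universal.
Variables (V : lmodType B) (D : B -> V).
Hypotheses (DD : forall x y, D (x + y) = D x + D y)
  (DM : forall x y, D (x * y) = x *: D y + y *: D x)
  (Dphi : forall a, D (phi a) = 0).

Lemma fglift_is_additive : zmod_morphism (fglift D).
Proof. exact: lift_is_additive. Qed.
HB.instance Definition _ :=
  GRing.isZmodMorphism.Build {freeg B / B} V (fglift D) fglift_is_additive.

Lemma fglift_scale (b : B) (r : {freeg B / B}) :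
  fglift D (b *: r) = b *: fglift D r.
Proof.
elim/freeg_gen_ind: r => [|r1 r2 IH1 IH2|k x].
- by rewrite scaler0 raddf0 scaler0.
- by rewrite scalerDr !raddfD /= IH1 IH2.
- by rewrite freeg_scaleU !liftU scalerA.
Qed.
HB.instance Definition _ :=
  GRing.isScalable.Build B {freeg B / B} V *:%R (fglift D) fglift_scale.

(** The kernel as a submodule: containing the defining relations, it contains
    their span. *)
Definition fglift_ker : {pred {freeg B / B}} := fun r => fglift D r == 0.

Lemma fglift_kerE r : (r \in fglift_ker) = (fglift D r == 0).
Proof. by []. Qed.

Lemma fglift_ker_closed : submod_closed fglift_ker.
Proof.
split=> [|b x y]; rewrite !fglift_kerE ?raddf0 //.
by move=> /eqP x0 /eqP y0; rewrite raddfD /= fglift_scale x0 y0 scaler0 addr0.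
Qed.
HB.instance Definition _ := GRing.isSubmodClosed.Build B {freeg B / B}
  fglift_ker fglift_ker_closed.

Lemma fglift_rel0 r : r \in span_mod (kaehler_rel phi) -> fglift D r = 0.
Proof.
rewrite unfold_in => /asboolP /(_ fglift_ker) H; apply/eqP; apply: H => {}r.
rewrite fglift_kerE => -[[x [y ->]]|[x [y ->]]|[a ->]];
  rewrite ?raddfB /= ?fglift_scale !liftU !scale1r.
- by rewrite DD -addrA -opprD subrr.
- by rewrite DM -addrA -opprD subrr.
- by rewrite Dphi.
Qed.

Definition kaehler_lift (w : Omega) : V := fglift D (quotmod_repr w).

Lemma kaehler_lift_pi r : kaehler_lift (quotmod_pi _ r) = fglift D r.
Proof.
have /fglift_rel0 : quotmod_repr (quotmod_pi (span_mod (kaehler_rel phi)) r) - r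
    \in span_mod (kaehler_rel phi) by rewrite -quotmod_eq quotmod_reprK.
by rewrite raddfB => /eqP; rewrite subr_eq0 => /eqP.
Qed.

Lemma kaehler_lift_is_additive : zmod_morphism kaehler_lift.
Proof.
move=> x y; rewrite -[x]quotmod_reprK -[y]quotmod_reprK -raddfB.
by rewrite !kaehler_lift_pi raddfB.
Qed.
HB.instance Definition _ :=
  GRing.isZmodMorphism.Build Omega V kaehler_lift kaehler_lift_is_additive.

Lemma kaehler_lift_is_scalable : scalable kaehler_lift.
Proof.
by move=> b x; rewrite -[x]quotmod_reprK -linearZ !kaehler_lift_pi linearZ.
Qed.
HB.instance Definition _ :=
  GRing.isScalable.Build B Omega V *:%R kaehler_lift kaehler_lift_is_scalable.

(** The universal property of [kaehler]: a derivation over [A] factors through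
    it. *)
Theorem kaehler_universal :
  exists f : {linear Omega -> V}, forall x, f (d x) = D x.
Proof.
by exists kaehler_lift => x; rewrite /= kaehler_lift_pi liftU scale1r.
Qed.

End Universal.
End KaehlerTheory.

Lemma lmod_isomorphic_bij (R : nzRingType) (U V : lmodType R)
    (f : {linear U -> V}) :
  (forall x, f x = 0 -> x = 0) -> (forall y, exists x, f x = y) ->
  lmod_isomorphic U V.
Proof.
move=> inj surj; exists f; exists (fun y => projT1 (cid (surj y))).
- move=> x; apply/eqP; rewrite -subr_eq0; apply/eqP/inj.
  by rewrite raddfB; case: cid => /= z ->; rewrite subrr.
- by move=> y; case: cid.
Qed.

(** * Differentials of a directed union of monogenic algebras *)

Section DirectedMonogenic.
Variables (A B : comNzRingType) (phi : {rmorphism A -> B}).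
Variables (M : lmodType B) (I : Type).
Variables (u : I -> B) (P : I -> {poly A}) (h : I -> M).
Local Notation "F .<[ x ]>" := (map_poly phi F).[x]
  (at level 2, left associativity, format "F .<[ x ]>").

(** Level [k] refines level [i] when [u i] is an affine function of [u k] over
    [A] and the image [h i] prescribed for [d (u i)] is the one that this
    forces, since then [d (u i) = phi s *: d (u k)]. *)
Definition refines i k := exists s t : A,
  u i = phi s * u k + phi t /\ h i = phi s *: h k.

Hypothesis generated : forall b, exists i F, b = F.<[u i]>.
Hypothesis root_P : forall i, (P i).<[u i]> = 0.
Hypothesis kernel_P : forall i F, F.<[u i]> = 0 -> exists q, F = q * P i.
Hypothesis torsionfree : forall i b, b *: h i = 0 -> b = 0.
Hypothesis directed : forall i j, exists2 k, refines i k & refines j k.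

Variables S N : submodClosed M.
Hypothesis mem_S : forall m, m \in S <-> exists i b, m = b *: h i.
Hypothesis mem_N : forall m,
  m \in N <-> exists i b, m = (b * (P i)^`().<[u i]>) *: h i.

Lemma directed_sub : {subset N <= S}.
Proof. by move=> m /mem_N[i [b ->]]; apply/mem_S; exists i; eexists. Qed.

(** The derivative of [q * P i] at [u i] is [q(u i) * P_i'(u i)], because
    [P i] vanishes there; this is what makes [N] the right denominator. *)
Lemma deriv_kernel i F : F.<[u i]> = 0 -> F^`().<[u i]> *: h i \in N.
Proof.
case/kernel_P=> q ->; apply/mem_N; exists i, q.<[u i]>.
by rewrite derivM rmorphD !rmorphM !hornerE root_P mulr0 add0r.
Qed.

(** Substituting [s X + t] turns a polynomial expression in [u i] into one in
    [u k]; by the chain rule the derivative picks up the factor [s], which is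
    exactly the ratio of [h i] to [h k]. *)
Lemma refines_poly i k F : refines i k -> exists2 F1,
  F1.<[u k]> = F.<[u i]> & F1^`().<[u k]> *: h k = F^`().<[u i]> *: h i.
Proof.
case=> s [t [uE hE]]; exists (F \Po (s *: 'X + t%:P)).
  rewrite map_comp_poly horner_comp rmorphD /= map_polyZ map_polyX map_polyC.
  by rewrite !hornerE uE.
rewrite deriv_comp derivD derivC addr0 derivZ derivX rmorphM hornerM /=.
rewrite map_comp_poly horner_comp rmorphD /= !map_polyZ map_polyX map_polyC.
by rewrite rmorph1 !hornerE /= -uE hE mulr1 scalerA.
Qed.

(** Modulo [N], [F'(u i) h_i] depends only on the element [F(u i)]: after
    passing to a common level, two expressions differ by an element of the
    kernel. *)
Lemma deriv_unique i j F H : F.<[u i]> = H.<[u j]> ->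
  F^`().<[u i]> *: h i - H^`().<[u j]> *: h j \in N.
Proof.
have [k /(refines_poly F)[F1 EF <-] /(refines_poly H)[H1 EH <-]] :=
  directed i j.
move=> FH; rewrite -scalerBl.
have -> : F1^`().<[u k]> - H1^`().<[u k]> = (F1 - H1)^`().<[u k]>.
  by rewrite derivB rmorphB !hornerE.
apply: deriv_kernel.
by rewrite rmorphB !hornerE EF EH FH subrr.
Qed.

Fact level_mem i b : b *: h i \in S.
Proof. by apply/mem_S; exists i, b. Qed.

Definition level_class i b : subquot S N :=
  quotmod_pi (@sub_in _ _ S N) (Sub (b *: h i) (level_mem i b)).

Lemma level_class_eq i j b c :
  (level_class i b == level_class j c) = (b *: h i - c *: h j \in N).
Proof. by rewrite quotmod_eq. Qed.

Lemma level_classD i b c :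
  level_class i (b + c) = level_class i b + level_class i c.
Proof.
rewrite /level_class -raddfD; congr (quotmod_pi _ _).
by apply: val_inj; rewrite /= scalerDl.
Qed.

Lemma level_classZ i b c : level_class i (b * c) = b *: level_class i c.
Proof.
rewrite /level_class -[RHS]quotmod_pi_scale; congr (quotmod_pi _ _).
by apply: val_inj; rewrite /= scalerA.
Qed.

Lemma generated_sig b : {iF : I * {poly A} | b = iF.2.<[u iF.1]>}.
Proof. by apply: cid; have [i [F ->]] := generated b; exists (i, F). Qed.

(** The derivation sending [F(u i)] to the class of [F'(u i) h_i], defined by
    choosing an expression; [level_derivE] says that any expression will do. *)
Definition level_deriv b : subquot S N :=
  let: exist (i, F) _ := generated_sig b in level_class i F^`().<[u i]>.

Lemma level_derivE i F : level_deriv F.<[u i]> = level_class i F^`().<[u i]>.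
Proof.
rewrite /level_deriv; case: generated_sig => -[j H] /= E.
by apply/eqP; rewrite level_class_eq deriv_unique.
Qed.

Lemma common_level x y : exists i F H, x = F.<[u i]> /\ y = H.<[u i]>.
Proof.
have [i [F ->]] := generated x; have [j [H ->]] := generated y.
have [k /(refines_poly F)[F1 EF _] /(refines_poly H)[H1 EH _]] := directed i j.
by exists k, F1, H1.
Qed.

Lemma level_derivD x y : level_deriv (x + y) = level_deriv x + level_deriv y.
Proof.
have [i [F [H [-> ->]]]] := common_level x y.
rewrite -hornerD -rmorphD !level_derivE derivD rmorphD hornerD.
exact: level_classD.
Qed.

Lemma level_derivM x y :
  level_deriv (x * y) = x *: level_deriv y + y *: level_deriv x.
Proof.
have [i [F [H [-> ->]]]] := common_level x y.
rewrite -hornerM -rmorphM !level_derivE derivM rmorphD !rmorphM.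
by rewrite hornerD !hornerM level_classD mulrC !level_classZ addrC.
Qed.

Lemma level_deriv_base a : level_deriv (phi a) = 0.
Proof.
(* An expression for 0 is used only for its index: any level will do. *)
have [i _] := generated 0.
have -> : phi a = a%:P.<[u i]> by rewrite map_polyC hornerC.
rewrite level_derivE derivC raddf0 horner0.
by rewrite -[0 in LHS](mul0r 0) level_classZ scale0r.
Qed.

(** By the chain rule every form is a multiple of some [d (u i)] at a fine
    enough level, so injectivity can be tested on such forms. *)
Lemma kaehler_level_d w : exists i b, w = b *: kaehler_d phi (u i).
Proof.
have refine_d i k b : refines i k ->
    exists c, b *: kaehler_d phi (u i) = c *: kaehler_d phi (u k).
  case=> s [t [-> _]]; exists (b * phi s).
  rewrite kaehler_dD kaehler_d_base addr0 kaehler_dM kaehler_d_base.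
  by rewrite scaler0 addr0 scalerA.
elim/kaehler_ind: w => [|_ _ [i [b ->]] [j [c ->]]|b x].
- by have [i _] := generated 0; exists i, 0; rewrite scale0r.
- have [k /(refine_d _ _ b)[b' ->] /(refine_d _ _ c)[c' ->]] := directed i j.
  by exists k, (b' + c'); rewrite scalerDl.
- have [i [F ->]] := generated x; exists i; eexists.
  by rewrite kaehler_d_horner scalerA.
Qed.

(** Injectivity: if [b *: h i] lies in [N], compare it at a common level [k]
    with the [x P_j'(u j) *: h j] that it equals.  As [h k] is torsion-free, the
    same equation holds between the coefficients of [d (u k)], hence
    [b *: d (u i) = x P_j'(u j) *: d (u j) = x *: d (P_j(u j)) = 0]. *)
Theorem kaehler_directed : lmod_isomorphic (kaehler phi) (subquot S N).
Proof.
have [psi psi_d] :=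
  kaehler_universal level_derivD level_derivM level_deriv_base.
have psiE i b : psi (b *: kaehler_d phi (u i)) = level_class i b.
  rewrite linearZ /= psi_d.
  have {1}-> : u i = 'X.<[u i]> by rewrite map_polyX hornerX.
  by rewrite level_derivE derivX rmorph1 hornerC -level_classZ mulr1.
apply: (@lmod_isomorphic_bij _ _ _ psi).
- move=> w; have [i [b ->]] := kaehler_level_d w; rewrite psiE.
  have -> : 0 = level_class i 0.
    by rewrite -[0 in RHS](mul0r 0) level_classZ scale0r.
  move/eqP; rewrite level_class_eq scale0r subr0 => /mem_N[j [x bh]].
  have [k [s [t [ui hi]]] [s' [t' [uj hj]]]] := directed i j.
  have bs : b * phi s = x * (P j)^`().<[u j]> * phi s'.
    apply/eqP; rewrite -subr_eq0; apply/eqP/(@torsionfree k).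
    by rewrite scalerBl -!scalerA -hi -hj bh !scalerA subrr.
  have dE s0 t0 : kaehler_d phi (phi s0 * u k + phi t0)
      = phi s0 *: kaehler_d phi (u k).
    rewrite kaehler_dD kaehler_d_base addr0 kaehler_dM kaehler_d_base.
    by rewrite scaler0 addr0.
  rewrite ui dE scalerA bs -scalerA -(dE _ t') -uj -scalerA.
  by rewrite -kaehler_d_horner root_P -[0](rmorph0 phi) kaehler_d_base scaler0.
- move=> y; rewrite -[y]quotmod_reprK; case: (quotmod_repr y) => m mS.
  have [i [b bE]] := (mem_S m).1 mS.
  exists (b *: kaehler_d phi (u i)); rewrite psiE; congr (quotmod_pi _ _).
  by apply: val_inj; rewrite /= bE.
Qed.

End DirectedMonogenic.

(** * Values, fractional ideals and Gauss's lemma *)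

Section Values.
Variables (L : fieldType) (G : orderedAbelianType) (v : valuation L G).
Implicit Types x y a : L.

Lemma oag_subr_ge0 (s t : G) : (0 <= t - s) = (s <= t).
Proof.
apply/idP/idP => [/(oag_leD2r s)|/(oag_leD2r (- s))].
  by rewrite add0r subrK.
by rewrite subrr.
Qed.

Lemma oag_subr_gt0 (s t : G) : (0 < t - s) = (s < t).
Proof.
by rewrite !ltNge -oag_subr_ge0 -(oag_subr_ge0 t) !(sub0r, opprB).
Qed.

Lemma val_finite x : x != 0 -> exists t, v x = fin t.
Proof. by rewrite -(val_eq_infty v); case: (v x) => [t|//]; exists t. Qed.

Lemma val_div x a : a != 0 -> v (x / a) = sub_infty (v x) (v a).
Proof.
move=> a0; have [t at_] := val_finite a0.
have := val_mul v (x / a) a; rewrite divfK // at_ => ->.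
by case: (v (x / a)) => [s|//]; rewrite /= addrK.
Qed.

Lemma val_div_ge0 x a : a != 0 -> (fin 0 <= v (x / a)) = (v a <= v x).
Proof.
move=> a0; rewrite val_div //; have [t ->] := val_finite a0.
by case: (v x) => [s|//]; rewrite [LHS]le_fin oag_subr_ge0.
Qed.

Lemma val_div_gt0 x a : a != 0 -> (fin 0 < v (x / a)) = (v a < v x).
Proof.
move=> a0; rewrite val_div //; have [t ->] := val_finite a0.
by case: (v x) => [s|//]; rewrite [LHS]lt_fin oag_subr_gt0 -lt_fin.
Qed.

Lemma val_infty_le x : v 0 <= v x -> x = 0.
Proof.
by rewrite val0 => le_x; apply/eqP; rewrite -(val_eq_infty v) eq_le lex_infty.
Qed.

Lemma val_leM x y a : v x <= v y -> v (a * x) <= v (a * y).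
Proof.
have [->|x0] := eqVneq x 0.
  by move=> /val_infty_le->; rewrite mulr0.
have [->|a0] := eqVneq a 0; first by rewrite !mul0r.
rewrite -val_div_ge0 // -val_div_ge0 ?mulf_neq0 //.
by rewrite invfM mulrACA divff // mul1r.
Qed.

(** Turns inequalities between values into divisibility, also for [a = 0]. *)
Lemma val_leP x a : v a <= v x <-> exists b : valring v, x = val b * a.
Proof.
split=> [|[b ->]].
  have [->|a0] := eqVneq a 0.
    by move=> /val_infty_le->; exists 0; rewrite mulr0.
  rewrite -val_div_ge0 // => va; exists (Sub (x / a) va).
  by rewrite SubK divfK.
rewrite mulrC -[X in v X <= _]mulr1; apply: val_leM.
by rewrite Defs.val1; exact: (valP b).
Qed.

Lemma valring_lift x :
  fin 0 <= v x -> exists y : valring v, valring_val v y = x.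
Proof. by move=> x0; exists (Sub x x0); rewrite /valring_val SubK. Qed.

Lemma valX_eq x y n : v x = v y -> v (x ^+ n) = v (y ^+ n).
Proof. by move=> xy; elim: n => // n IH; rewrite !exprS !val_mul IH xy. Qed.

Lemma final_closureP (I : Type) (f : I -> with_infty G) t :
  final_closure (range f) t <-> exists i, f i <= t.
Proof.
split=> [H|[i fi] T [Tf fT]].
  apply: (H [set s | exists i, f i <= s]); split.
    by move=> s t' [i fi] st; exists i; apply: le_trans st.
  by move=> _ [i _ <-]; exists i.
by apply: Tf fi; apply: fT; exists i.
Qed.

Lemma IS_closureP (I : Type) (f : I -> with_infty G) b :
  IS v (final_closure (range f)) b <-> exists i, f i <= v b.
Proof.
split=> [[s /final_closureP[i fi] sb]|[i fi]].
  by exists i; apply: le_trans sb.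
by exists (v b) => //; apply/final_closureP; exists i.
Qed.

Section FractionalIdeal.
Variables (I : Type) (i0 : I) (a : I -> L).

Definition frac_ideal : {pred restr (valring_val v)} :=
  fun b => `[< exists i, v (a i) <= v (b : L) >].

Lemma frac_idealP (b : restr (valring_val v)) :
  reflect (exists i, v (a i) <= v (b : L)) (b \in frac_ideal).
Proof. exact: asboolP. Qed.

Lemma frac_ideal_closed : submod_closed frac_ideal.
Proof.
split=> [|b x y /frac_idealP[i ix] /frac_idealP[j jy]]; apply/frac_idealP.
  by exists i0; rewrite val0 lex_infty.
have bx : v (a i) <= v (valring_val v b * x).
  apply/val_leP; have [x1 ->] := (val_leP _ _).1 ix.
  by exists (b * x1); rewrite mulrA -rmorphM.
have [ij|/ltW ji] := leP (v (a i)) (v (a j)); [exists i | exists j];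
  rewrite -[X in _ + X]opprK; apply: val_subring_ge; rewrite ?valN //.
- exact: le_trans jy.
- exact: le_trans bx.
Qed.
HB.instance Definition _ := GRing.isSubmodClosed.Build (valring v)
  (restr (valring_val v)) frac_ideal frac_ideal_closed.

(** Such a union of principal ideals is closed under sums because principal
    fractional ideals of a valuation ring are totally ordered by inclusion. *)
Lemma frac_ideal_exists : exists S : submodClosed (restr (valring_val v)),
  forall b : restr (valring_val v), b \in S <-> exists i, v (a i) <= v (b : L).
Proof.
exists (frac_ideal : submodClosed (restr (valring_val v))) => b.
by split=> /frac_idealP.
Qed.

End FractionalIdeal.
End Values.

Section PolyValring.
Variables (K : fieldType) (G : orderedAbelianType) (w : valuation K G).
Local Notation O := (valring w).
Local Notation toK := (map_poly (valring_val w)).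

Lemma valring_poly_lift (p : {poly K}) :
  (forall i, fin 0 <= w p`_i) -> exists P : {poly O}, p = toK P.
Proof.
move=> p0; exists (\poly_(i < size p) (Sub p`_i (p0 i) : O)).
apply/polyP=> i; rewrite coef_map coef_poly.
case: ifP => [_|/negbT]; first by rewrite /= /valring_val SubK.
by rewrite -leqNgt => /leq_sizeP->; rewrite // rmorph0.
Qed.

Lemma toK_inj : injective toK.
Proof. by apply: map_inj_poly => //; exact: val_inj. Qed.

(** Take for [r] a coefficient of least value; the residue of [p / r] is nonzero
    because it has a coefficient 1. *)
Lemma primitive_part (p : {poly K}) : p != 0 ->
  exists (r : K) (P : {poly O}), [/\ r != 0, p = r *: toK P,
    map_poly (@residue K G w) P != 0,
    forall i, w r <= w p`_i & exists i : 'I_(size p), p`_i = r].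
Proof.
move=> p0; have sp : (0 < size p)%N by rewrite size_poly_gt0.
case: (@arg_minP _ _ _ (Ordinal sp) xpredT (fun i : 'I_(size p) => w p`_i) isT).
move=> j _ jmin; set r := p`_j in jmin.
have rmin i : w r <= w p`_i.
  have [lt_i|ge_i] := ltnP i (size p); first exact: (jmin (Ordinal lt_i)).
  by rewrite nth_default // val0 lex_infty.
(* A zero coefficient has value infinity, above that of the leading one. *)
have r0 : r != 0.
  have := rmin (size p).-1; rewrite -lead_coefE; apply: contraTneq => ->.
  rewrite val0 -ltNge lt_neqAle lex_infty andbT val_eq_infty.
  by rewrite lead_coef_eq0.
have [|P PE] := @valring_poly_lift (r^-1 *: p).
  by move=> i; rewrite coefZ mulrC val_div_ge0.
exists r, P; split=> //; last by exists j.
  by rewrite -PE scalerA divff // scale1r.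
apply/eqP => /(congr1 (fun q : {poly _} => q`_j)); rewrite coef0 coef_map /=.
move/eqP; rewrite -(rmorph0 (@residue K G w)) residue_eq subr0 inE.
have -> : val P`_j = 1.
  by rewrite -[LHS]/(valring_val w _) -coef_map -PE coefZ mulVf.
by rewrite Defs.val1 ltxx.
Qed.

(** If [q] had a coefficient of negative value, then dividing by one of least
    value would give a primitive [q1] such that [q1 * P] reduces to 0, although
    the polynomials over the residue field form a domain. *)
Lemma gauss_divides (P E : {poly O}) (q : {poly K}) :
  map_poly (@residue K G w) P != 0 -> q * toK P = toK E ->
  exists Q : {poly O}, q = toK Q.
Proof.
move=> P0 qP; have [->|q0] := eqVneq q 0; first by exists 0; rewrite rmorph0.
have [r [q1 [r0 qE q10 _ _]]] := primitive_part q0.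
have [r_ge0|r_lt0] := leP (fin 0) (w r).
  have [r1 r1E] := valring_lift r_ge0.
  by exists (r1 *: q1); rewrite map_polyZ qE /= r1E.
have rV_gt0 : fin 0 < w r^-1.
  by rewrite -[r^-1]mul1r val_div_gt0 // Defs.val1.
have E1 : toK (q1 * P) = r^-1 *: toK E.
  by rewrite rmorphM -qP qE -scalerAl scalerA mulVf // scale1r.
have := mulf_neq0 q10 P0; rewrite -rmorphM => /eqP[]; apply/polyP => i.
rewrite coef0 coef_map /=; apply/eqP.
rewrite -(rmorph0 (@residue K G w)) residue_eq subr0 inE.
rewrite -[val _]/(valring_val w _) -coef_map E1 coefZ coef_map mulrC.
by rewrite val_mul; apply: add_infty_gt0 => //; exact: (valP E`_i).
Qed.

End PolyValring.

(** * One level: the subring generated by (eta - c) / d *)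

Definition affine (K : fieldType) (c d : K) : {poly K} := d *: 'X + c%:P.

Lemma affineK (K : fieldType) (c d : K) : d != 0 ->
  affine (- (c / d)) d^-1 \Po affine c d = 'X.
Proof.
move=> d0; rewrite /affine comp_polyD comp_polyZ comp_polyX comp_polyC.
rewrite scalerDr scalerA mulVf // scale1r -addrA -[d^-1 *: _%:P]mul_polyC.
by rewrite -polyCM -polyCD mulrC addrN addr0.
Qed.

Lemma size_affine (K : fieldType) (c d : K) : d != 0 -> size (affine c d) = 2.
Proof.
move=> d0; have sX : size (d *: 'X) = 2 by rewrite size_scale ?size_polyX.
by rewrite size_polyDl sX // size_polyC; case: (c == 0).
Qed.

Section Level.
Variables (K : fieldType) (L : fieldExtType K) (G : orderedAbelianType).
Variable v : valuation L G.
Local Notation vK := (restrict v).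
Local Notation O := (valring v).
Local Notation OK := (valring vK).
Local Notation toK := (map_poly (valring_val vK)).
Local Notation "F .<[ x ]>" := (map_poly (valring_map v) F).[x]
  (at level 2, left associativity, format "F .<[ x ]>").
Local Notation "f .{ x }" := (map_poly (in_alg L) f).[x]
  (at level 2, left associativity, format "f .{ x }").

Lemma val_horner (F : {poly OK}) (u : O) :
  valring_val v F.<[u]> = (toK F).{valring_val v u}.
Proof. by rewrite -horner_map -!map_poly_comp. Qed.

Variables (eta : L) (c d : K) (u : O).
Hypotheses (d0 : d != 0) (uE : valring_val v u = (eta - c%:A) / d%:A).

Let dA0 : d%:A != 0 :> L.
Proof. by rewrite (fmorph_eq0 (in_alg L)). Qed.

Lemma horner_affine (f : {poly K}) :
  (f \Po affine c d).{valring_val v u} = f.{eta}.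
Proof.
rewrite map_comp_poly horner_comp /affine rmorphD /=.
rewrite map_polyZ map_polyX map_polyC.
by rewrite !hornerE /= uE mulrC divfK // subrK.
Qed.

Lemma horner_affineV (f : {poly K}) :
  (f \Po affine (- (c / d)) d^-1).{eta} = f.{valring_val v u}.
Proof.
rewrite map_comp_poly horner_comp /affine rmorphD /=.
rewrite map_polyZ map_polyX map_polyC.
rewrite !hornerE /= uE mulrBl -!in_algE fmorphV rmorphN fmorph_div /=.
by rewrite [_^-1 * eta]mulrC.
Qed.

Variables (g : {poly K}) (r : K) (P : {poly OK}).
Hypothesis g_root : g.{eta} = 0.
Hypothesis g_dvd : forall f : {poly K}, f.{eta} = 0 -> g %| f.
Hypotheses (r0 : r != 0) (PE : g \Po affine c d = r *: toK P).
Hypothesis P_primitive : map_poly (@residue K G vK) P != 0.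

Let rA0 : r%:A != 0 :> L.
Proof. by rewrite (fmorph_eq0 (in_alg L)). Qed.

Lemma level_root : P.<[u]> = 0.
Proof.
apply: val_inj; rewrite -[LHS]/(valring_val v _) val_horner.
apply: (mulfI rA0); rewrite rmorph0 mulr0.
by rewrite -[RHS]g_root -(horner_affine g) PE map_polyZ hornerZ.
Qed.

(** Over [K] a relation [F] is a multiple of [g] after the substitution, thus a
    multiple of [P]; primitivity of [P] makes the cofactor integral. *)
Lemma level_kernel F : F.<[u]> = 0 -> exists q, F = q * P.
Proof.
move=> Fu; have : (toK F \Po affine (- (c / d)) d^-1).{eta} = 0.
  by rewrite horner_affineV -val_horner Fu rmorph0.
move=> /g_dvd/dvdpP[q qE].
have qP : (r *: (q \Po affine c d)) * toK P = toK F.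
  rewrite -scalerAl scalerAr -PE -comp_polyM -qE -comp_polyA affineK //.
  by rewrite comp_polyXr.
have [Q QE] := gauss_divides P_primitive qP.
by exists Q; apply: (@toK_inj _ _ vK); rewrite rmorphM /= -QE -qP.
Qed.

Lemma level_deriv_val :
  valring_val v P^`().<[u]> = g^`().{eta} / r%:A * d%:A.
Proof.
apply: (mulfI rA0); rewrite mulrA [r%:A * (_ / _)]mulrC divfK // val_horner.
have := congr1 (fun f : {poly K} => f^`().{valring_val v u}) PE.
rewrite derivZ deriv_map map_polyZ hornerZ /= => <-.
rewrite deriv_comp /affine derivD derivC addr0 derivZ derivX alg_polyC.
by rewrite rmorphM hornerM /= horner_affine map_polyC hornerC.
Qed.

Hypothesis r_min : forall i, vK r <= vK (g \Po affine c d)`_i.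
Hypothesis r_coef :
  exists i : 'I_(size (g \Po affine c d)), (g \Po affine c d)`_i = r.
Hypothesis vd : v (eta - c%:A) = v d%:A.

(** The [Q]-expansion of [g] at [Q = X - c] is its Taylor expansion at [c], and
    [v (Q (eta)) = v d]; so the terms have the values of the coefficients of
    [g (d X + c)]. *)
Lemma nu_trunc_affine : nu_trunc v eta ('X - c%:P) g = v r%:A.
Proof.
set q := 'X - c%:P.
have q1 : (1 < size q)%N by rewrite size_XsubC.
have kE l : qcoef q g l = ((qcoef q g l)`_0)%:P.
  by apply: size1_polyC; have := size_qcoef g l q1; rewrite size_XsubC ltnS.
have coefE l : (l < size g)%N ->
    (g \Po affine c d)`_l = (qcoef q g l)`_0 * d ^+ l.
  move=> lg; rewrite {1}(qexpansion g q1) rmorph_sum coef_sum /=.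
  have E (i : 'I_(size g)) : ((qcoef q g i * q ^+ i) \Po affine c d)`_l
      = if i == Ordinal lg then (qcoef q g l)`_0 * d ^+ l else 0.
    rewrite comp_polyM rmorphXn /= comp_polyB comp_polyX comp_polyC addrK kE.
    rewrite comp_polyC exprZn mul_polyC coefZ coefZ coefXn -(inj_eq val_inj) /=.
    by rewrite eq_sym; case: eqP => [->|]; rewrite ?mulr1 ?mulr0.
  by rewrite (eq_bigr _ (fun i _ => E i)) -big_mkcond big_pred1_eq.
have nuE l : (l < size g)%N -> nu v eta (qcoef q g l * q ^+ l)
    = vK (g \Po affine c d)`_l.
  move=> lg; rewrite coefE // kE -[LHS]/(v _.{eta}) -[RHS]/(v (in_alg L _)).
  rewrite rmorphM rmorphXn rmorphB /= map_polyX !map_polyC !hornerE /=.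
  rewrite coefC eqxx -!in_algE [in RHS]rmorphM rmorphXn /=.
  by rewrite !val_mul (valX_eq _ vd).
rewrite /nu_trunc; apply/eqP; rewrite eq_le; apply/andP; split.
  case: r_coef => -[i /=]; rewrite size_comp_poly2 ?size_affine // => ig <-.
  by apply: (@bigmin_inf _ _ _ _ (Ordinal ig)) => //=; rewrite nuE.
apply/bigmin_geP; split=> [|i _]; first exact: lex_infty.
by rewrite nuE.
Qed.

End Level.

Section Refinement.
Variables (K : fieldType) (L : fieldExtType K) (G : orderedAbelianType).
Variables (v : valuation L G) (eta : L).
Variables (I : Type) (c d : I -> K) (u : I -> valring v).
Hypotheses (d0 : forall i, d i != 0)
  (vd : forall i, v (eta - (c i)%:A) = v (d i)%:A).
Hypothesis uE : forall i, valring_val v (u i) = (eta - (c i)%:A) / (d i)%:A.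

(** [u i = (d k / d i) u k + (c k - c i) / d i], where [c k - c i] is a
    difference of two elements of value at least [v (d i)]. *)
Lemma level_refines i k : v (eta - (c i)%:A) <= v (eta - (c k)%:A) ->
  refines (valring_map v) (M := restr (valring_val v)) u
    (fun i => (d i)%:A^-1) i k.
Proof.
move=> ik; have dA0 j : (d j)%:A != 0 :> L by rewrite (fmorph_eq0 (in_alg L)).
have s_ge0 : fin 0 <= restrict v (d k / d i).
  by rewrite val_div_ge0 // /restrict /= /restrict_fun -!vd.
have t_ge0 : fin 0 <= restrict v ((c k - c i) / d i).
  rewrite val_div_ge0 // /restrict /= /restrict_fun -vd scalerBl.
  have -> : (c k)%:A - (c i)%:A = (eta - (c i)%:A) - (eta - (c k)%:A) :> L.
    by rewrite opprB [RHS]addrC addrA subrK.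
  exact: val_subring_ge.
have [s sE] := valring_lift s_ge0; have [t tE] := valring_lift t_ge0.
have valE (a : valring (restrict v)) :
    valring_val v (valring_map v a) = (valring_val (restrict v) a)%:A by [].
exists s, t; split.
  apply: val_inj; rewrite -[LHS]/(valring_val v _) uE.
  rewrite -[RHS]/(valring_val v _) rmorphD rmorphM /= uE !valE sE tE.
  rewrite -!in_algE !fmorph_div rmorphB /=.
  rewrite mulrAC [_ * ((eta - (c k)%:A) / _)]mulrC divfK //.
  by rewrite -mulrDl addrA subrK.
rewrite -[RHS]/(valring_val v (valring_map v s) * (d k)%:A^-1).
by rewrite valE sE -!in_algE fmorph_div /= mulrAC divff // mul1r.
Qed.

End Refinement.

(** * From an exhausting chain to the differentials *)

(** That is, [f] is a polynomial in [(X - c) / d] with integral coefficients. *)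
Definition integral_at (K : fieldType) (G : orderedAbelianType)
    (w : valuation K G) (c d : K) (f : {poly K}) : Prop :=
  f \Po affine c d \is a polyOver (valring_pred w).

(** By the last clause the rings O_K[(eta - c i) / d i] exhaust the valuation
    ring of [L]. *)
Definition exhausting_levels (K : fieldType) (L : fieldExtType K)
    (G : orderedAbelianType) (v : valuation L G) (eta : L) (I : Type)
    (c d : I -> K) : Prop :=
  [/\ forall i, d i != 0, forall i, v (eta - (c i)%:A) = v (d i)%:A &
      forall x : L, fin 0 <= v x -> exists i (f : {poly K}),
        x = (map_poly (in_alg L) f).[eta]
        /\ integral_at (restrict v) (c i) (d i) f].

Section Assembly.
Variables (K : fieldType) (L : fieldExtType K) (G : orderedAbelianType).
Variables (v : valuation L G) (eta : L) (g : {poly K}) (I : Type) (c : I -> K).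
Local Notation "f .{ x }" := (map_poly (in_alg L) f).[x]
  (at level 2, left associativity, format "f .{ x }").
Hypotheses (g0 : g != 0) (g_root : g.{eta} = 0).
Hypothesis g_dvd : forall f : {poly K}, f.{eta} = 0 -> g %| f.

(** With [h i = 1 / d i], of value [alpha_ i], the denominators
    [P_i'(u i) * h i = g'(eta) / r i] have value [beta_ i]. *)
Theorem kaehler_of_levels (d : I -> K) (levels : exhausting_levels v eta c d)
    (Q : I -> {poly K}) (QE : forall i, Q i = 'X - (c i)%:P) :
  let alpha_ i := sub_infty (nu v eta (Q i)^`()) (nu v eta (Q i)) in
  let beta_ i := sub_infty (nu v eta g^`()) (nu_trunc v eta (Q i) g) in
  let alpha := final_closure (range alpha_) in
  let beta := final_closure (range beta_) in
  exists A B : submodClosed (restr (valring_val v)),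
    [/\ forall b : L, (b \in A) <-> IS v alpha b,
        forall b : L, (b \in B) <-> IS v beta b,
        {subset B <= A} &
        lmod_isomorphic (kaehler (valring_map v)) (subquot A B)].
Proof.
move=> alpha_ beta_ alpha beta; have [d0 vd integral] := levels.
have nuE f : nu v eta f = v f.{eta} by [].
have dA0 i : (d i)%:A != 0 :> L by rewrite (fmorph_eq0 (in_alg L)).
have /choice[u uE] : forall i, exists u : valring v,
    valring_val v u = (eta - (c i)%:A) / (d i)%:A.
  by move=> i; apply: valring_lift; rewrite val_div_ge0 // vd.
have gi0 i : g \Po affine (c i) (d i) != 0.
  by rewrite -size_poly_gt0 size_comp_poly2 ?size_affine ?size_poly_gt0.
have /choice[r /choice[P rPE]] := fun i => primitive_part (restrict v) (gi0 i).
(* The index that exhaustion supplies for 0 shows that [I] is inhabited. *)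
have [i0 _] := integral _ (valP (0 : valring v)).
have rA0 i : (r i)%:A != 0 :> L.
  by rewrite (fmorph_eq0 (in_alg L)); case: (rPE i).
have alphaE i : alpha_ i = v (d i)%:A^-1.
  rewrite /alpha_ QE !nuE derivXsubC rmorph1 hornerC.
  by rewrite rmorphB /= map_polyX map_polyC !hornerE /= vd -val_div // mul1r.
have betaE i : beta_ i = v (g^`().{eta} / (r i)%:A).
  rewrite /beta_ QE val_div // -nuE; congr sub_infty.
  by have [_ _ _ rm rc] := rPE i; apply: (nu_trunc_affine (d0 i) rm rc (vd i)).
have derivE i :
    valring_val v (map_poly (valring_map v) (P i)^`()).[u i] * (d i)%:A^-1
    = g^`().{eta} / (r i)%:A.
  have [r0 PE _ _ _] := rPE i.
  by rewrite (level_deriv_val (d0 i) (uE i) r0 PE) mulfK.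
have [A AE] := frac_ideal_exists v i0 (fun i => (d i)%:A^-1).
have [B BE] := frac_ideal_exists v i0 (fun i => g^`().{eta} / (r i)%:A).
have memA m : m \in A <->
    exists i b, m = b *: ((d i)%:A^-1 : restr (valring_val v)).
  rewrite AE; split=> -[i]; last first.
    by case=> b ->; exists i; apply/val_leP; exists b.
  by case/val_leP=> b ->; exists i, b.
have memB m : m \in B <-> exists i b,
    m = (b * (map_poly (valring_map v) (P i)^`()).[u i])
          *: ((d i)%:A^-1 : restr (valring_val v)).
  have scaleE i b : (b * (map_poly (valring_map v) (P i)^`()).[u i])
      *: ((d i)%:A^-1 : restr (valring_val v))
      = valring_val v b * (g^`().{eta} / (r i)%:A).
    by rewrite -derivE -scalerA.
  rewrite BE; split=> -[i]; last first.
    by case=> b ->; exists i; rewrite scaleE; apply/val_leP; exists b.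
  by case/val_leP=> b ->; exists i, b; rewrite scaleE.
exists A, B; split.
- move=> b; rewrite AE IS_closureP.
  by split=> -[i ib]; exists i; move: ib; rewrite alphaE.
- move=> b; rewrite BE IS_closureP.
  by split=> -[i ib]; exists i; move: ib; rewrite betaE.
- exact: (directed_sub memA memB).
- apply: (kaehler_directed _ _ _ _ _ memA memB).
  + move=> b; have [i [f [bE f_int]]] := integral _ (valP b).
    have [F FE] := valring_poly_lift (polyOverP f_int).
    exists i, F; apply: val_inj; rewrite -[RHS]/(valring_val v _) val_horner.
    by rewrite -FE (horner_affine (d0 i) (uE i)).
  + move=> i; have [r0 PE _ _ _] := rPE i.
    exact: (level_root (d0 i) (uE i) g_root r0 PE).
  + move=> i F; have [r0 PE Pp _ _] := rPE i.
    exact: (level_kernel (d0 i) (uE i) g_dvd PE Pp).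
  + move=> i b bh; apply: val_inj; apply/eqP; move/eqP: bh.
    rewrite -[X in X == _]/(valring_val v b * (d i)%:A^-1) mulf_eq0 invr_eq0.
    by rewrite (negPf (dA0 i)) orbF.
  + move=> i j; have refine := level_refines d0 vd uE.
    have refl k : refines (valring_map v) (M := restr (valring_val v)) u
      (fun i => (d i)%:A^-1) k k by apply: refine.
    have [ij|/ltW ji] := leP (v (eta - (c i)%:A)) (v (eta - (c j)%:A)).
      by exists j => //; apply: refine.
    by exists i => //; apply: refine.
Qed.

End Assembly.

(** * Polynomials in the generator and their residues *)

Lemma val_sub_eq (L : fieldType) (G : orderedAbelianType)
    (v : valuation L G) x y :
  v x < v y -> v (x - y) = v x.
Proof.
move=> xy; apply/eqP; rewrite eq_le val_subring_ge ?lexx ?(ltW xy) // andbT.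
rewrite leNgt; apply/negP => lt_x.
have yN : v x < v (- y) by rewrite valN.
by have := val_sub_gt lt_x yN; rewrite opprK subrK ltxx.
Qed.

Section GeneratedField.
Variables (K : fieldType) (L : fieldExtType K) (eta : L) (g : {poly K}).
Local Notation "f .{ x }" := (map_poly (in_alg L) f).[x]
  (at level 2, left associativity, format "f .{ x }").
Hypothesis g_min : map_poly (in_alg L) g = minPoly 1%AS eta.

Lemma minPoly_neq0 : g != 0.
Proof.
by rewrite -(map_poly_eq0 (in_alg L)) g_min monic_neq0 ?monic_minPoly.
Qed.

Lemma minPoly_root : g.{eta} = 0.
Proof. by rewrite g_min minPolyxx. Qed.

Lemma minPoly_dvd (f : {poly K}) : f.{eta} = 0 -> g %| f.
Proof.
move=> /rootP fr; rewrite -(dvdp_map (in_alg L)) g_min.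
by apply: minPoly_dvdp fr; apply: alg_polyOver.
Qed.

Lemma small_poly_repr : <<1; eta>>%VS = fullv -> forall x : L,
  exists2 f : {poly K}, (size f <= \dim {:L})%N & x = f.{eta}.
Proof.
move=> gen x; have /polyOver1P[f fE] := Fadjoin_polyOver 1%AS eta x.
exists f; last by rewrite -fE Fadjoin_poly_eq // gen memvf.
rewrite -(size_map_poly (in_alg L)) -fE.
rewrite (leq_trans (size_Fadjoin_poly _ _ _)) //.
by rewrite -gen dim_Fadjoin dimv1 muln1.
Qed.

End GeneratedField.

Section ResidueHorner.
Variables (K : fieldType) (L : fieldExtType K) (G : orderedAbelianType).
Variable v : valuation L G.

Lemma residue_horner (F : {poly valring (restrict v)}) (u : valring v) :
  residue (map_poly (valring_map v) F).[u]
    = (map_poly (resfield_map v)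
        (map_poly (@residue K G (restrict v)) F)).[residue u].
Proof.
rewrite -horner_map -!map_poly_comp; congr (_.[_]).
by apply: eq_map_poly => a /=; rewrite resfield_mapE.
Qed.

Lemma residue_neq0 (x : valring v) :
  (residue x != 0) = (v (valring_val v x) == fin 0).
Proof.
rewrite -(rmorph0 (@residue L G v)) residue_eq subr0 inE -leNgt eq_le.
by rewrite [X in _ = _ && X](valP x) andbT.
Qed.

End ResidueHorner.

(** * Pure immediate extensions *)

Section Immediate.
Variables (K : fieldType) (L : fieldExtType K) (G : orderedAbelianType).
Variable v : valuation L G.
Hypothesis imm : immediate v.

Lemma immediate_level (x : L) : x != 0 -> exists2 d : K, d != 0 & v x = v d%:A.
Proof.
move=> x0; have [t xt] := val_finite v x0.
have [] : value_group (restrict v) t by rewrite -imm.1; exists x.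
move=> d dt; exists d; last by rewrite xt -dt.
by rewrite -(val_eq_infty (restrict v)) dt.
Qed.

(** Equality of residue fields approximates [x / d] by an element of [K]; this
    is why the values [v (eta - c)] have no maximum. *)
Lemma immediate_approx (x : L) : x != 0 -> exists a : K, v x < v (x - a%:A).
Proof.
move=> x0; have [d d0 xd] := immediate_level x0.
have dA0 : d%:A != 0 :> L by rewrite (fmorph_eq0 (in_alg L)).
have [y yE] : exists y : valring v, valring_val v y = x / d%:A.
  by apply: valring_lift; rewrite val_div_ge0 // xd.
have [b /esym] := imm.2 (residue y).
rewrite -[b]resfield_reprK resfield_mapE => /eqP; rewrite residue_eq inE.
rewrite -[val _]/(valring_val v (y - _)) rmorphB /= yE.
set a := resfield_repr b.
rewrite -[valring_val v (valring_map v a)]/(valring_val _ a)%:A => lt0.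
exists (valring_val _ a * d); rewrite xd -val_div_gt0 // -in_algE rmorphM /=.
by rewrite mulrBl mulfK.
Qed.

End Immediate.

Section PureImmediate.
Variables (K : fieldType) (L : fieldExtType K) (G : orderedAbelianType).
Variables (v : valuation L G) (eta : L) (I : Type) (c d : I -> K).
Local Notation vK := (restrict v).
Local Notation gam i := (v (eta - (c i)%:A)).
Local Notation "f .{ x }" := (map_poly (in_alg L) f).[x]
  (at level 2, left associativity, format "f .{ x }").
Hypotheses (d0 : forall i, d i != 0) (vd : forall i, gam i = v (d i)%:A).
Hypothesis no_max : forall i, exists j, gam i < gam j.

Lemma val_center_diff i j : gam i < gam j -> vK (c j - c i) = vK (d i).
Proof.
move=> ij; rewrite /restrict /= /restrict_fun -vd -(val_sub_eq ij).
by rewrite scalerBl opprB [in RHS]addrC addrA subrK.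
Qed.

(** One step of Newton interpolation per degree: in
    [f = f(c i) + ((X - c i) / d i) * f1] the quotient [f1] again has integral
    values at the later centres, because [c j - c i] has the same value as
    [d i] there.  A strictly finer level must be taken at each step. *)
Lemma integral_of_values n (f : {poly K}) i : (size f <= n)%N ->
    (forall j, gam i <= gam j -> fin 0 <= vK f.[c j]) ->
  exists2 j, gam i <= gam j & integral_at vK (c j) (d j) f.
Proof.
elim: n => [|n IH] in f i * => fn f_ge0.
  exists i => //; have -> : f = 0 by apply/eqP; rewrite -size_poly_eq0 -leqn0.
  by rewrite /integral_at comp_poly0 rpred0.
have [i' ii'] := no_max i.
pose f1 := d i *: ((f - f.[c i]%:P) %/ ('X - (c i)%:P)).
have fE : f = f.[c i]%:P + ((d i)^-1 *: ('X - (c i)%:P)) * f1.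
  rewrite /f1 -scalerAr -scalerAl scalerA divff // scale1r mulrC.
  by rewrite divpK ?subrKC // dvdp_XsubCl /root !hornerE subrr.
have sf1 : (size f1 <= n)%N.
  rewrite size_scale // size_divp ?polyXsubC_eq0 // size_XsubC leq_subLR.
  rewrite (leq_trans (size_polyD _ _)) // size_polyN geq_max fn.
  by rewrite (leq_trans (size_polyC_leq1 _)).
have f1_ge0 j : gam i' <= gam j -> fin 0 <= vK f1.[c j].
  move=> i'j; have ij : gam i < gam j by apply: lt_le_trans i'j.
  have cij : c j - c i != 0.
    by rewrite -(val_eq_infty vK) val_center_diff // val_eq_infty.
  have -> : f1.[c j] = (f.[c j] - f.[c i]) / ((c j - c i) / d i).
    apply: (canRL (mulfK _)); rewrite ?mulf_neq0 ?invr_eq0 //.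
    have -> : f.[c j] = f.[c i] + (d i)^-1 * (c j - c i) * f1.[c j].
      by rewrite {1}fE !hornerE.
    by rewrite addrAC subrr add0r mulrC [(d i)^-1 * _]mulrC.
  rewrite val_div_ge0 ?mulf_neq0 ?invr_eq0 //.
  apply: (@le_trans _ _ (fin 0)); last first.
    by apply: val_subring_ge; apply: f_ge0; rewrite ?lexx // ltW.
  by rewrite leNgt val_div_gt0 // val_center_diff // ltxx.
have [j i'j f1_int] := IH f1 i' sf1 f1_ge0.
have ij : gam i < gam j by apply: lt_le_trans i'j.
exists j; first exact: ltW.
rewrite /integral_at fE comp_polyD comp_polyM comp_polyC rpredD //.
  by rewrite polyOverC; apply: f_ge0.
apply: rpredM => //.
rewrite comp_polyZ comp_polyB comp_polyX comp_polyC /affine.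
rewrite -addrA -polyCB scalerDr scalerA -[_ *: _%:P]mul_polyC -polyCM.
rewrite rpredD ?polyOverC //.
  apply/polyOverP => l; rewrite coefZ coefX mulr_natr rpredMn //.
  by rewrite inE mulrC val_div_ge0 // /restrict /= /restrict_fun -!vd ltW.
by rewrite inE mulrC val_div_ge0 // val_center_diff.
Qed.

(** At a finer level [k] the points [eta] and [c k] have the same coordinate
    modulo the maximal ideal in the variable [(X - c j) / d j], in which [f] is
    integral; so [f (eta)] and [f (c k)] have the same residue. *)
Lemma horner_unit (f : {poly K}) j : integral_at vK (c j) (d j) f ->
    (forall k, gam j <= gam k -> vK f.[c k] = fin 0) ->
  v f.{eta} = fin 0.
Proof.
move=> f_int f_unit; have [k jk] := no_max j.
have [F FE] := valring_poly_lift (polyOverP f_int).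
have dA0 : (d j)%:A != 0 :> L by rewrite (fmorph_eq0 (in_alg L)).
have [u uE] : exists u : valring v,
    valring_val v u = (eta - (c j)%:A) / (d j)%:A.
  by apply: valring_lift; rewrite val_div_ge0 // vd.
have [a aE] : exists a : valring vK, valring_val vK a = (c k - c j) / d j.
  by apply: valring_lift; rewrite val_div_ge0 // val_center_diff.
have ua : residue u = residue (valring_map v a).
  apply/eqP; rewrite residue_eq inE.
  rewrite -[val _]/(valring_val v (u - valring_map v a)) rmorphB /= uE.
  rewrite -[valring_val v (valring_map v a)]/(valring_val vK a)%:A aE.
  rewrite -!in_algE fmorph_div rmorphB /= -mulrBl val_div_gt0 // -vd.
  by rewrite opprB addrA subrK.
rewrite -(horner_affine (d0 j) uE) FE -val_horner; apply/eqP.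
rewrite -residue_neq0 residue_horner ua -residue_horner horner_map residue_neq0.
rewrite -[valring_val v _]/(valring_val vK F.[a])%:A -horner_map /= aE -FE.
rewrite horner_comp /affine hornerD hornerZ hornerX hornerC.
rewrite mulrC divfK // subrK.
by apply/eqP; apply: f_unit; apply: ltW.
Qed.

(** If the eventual value of the [f (c i)] is not negative, interpolation
    applies to [f].  Otherwise it applies to [f / f(c0)], whose values at the
    late centres are units, so [f (eta)] would have the same negative value. *)
Lemma pure_integral (f : {poly K}) (c0 : K) i0 :
    (forall b, v (eta - c0%:A) <= v (eta - b%:A) -> vK f.[b] = vK f.[c0]) ->
    v (eta - c0%:A) <= gam i0 -> fin 0 <= v f.{eta} ->
  exists i, integral_at vK (c i) (d i) f.
Proof.
move=> f_const c0i f_ge0.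
have fcE j : gam i0 <= gam j -> vK f.[c j] = vK f.[c0].
  by move=> ij; apply: f_const; apply: le_trans ij.
have [val_ge0|val_lt0] := leP (fin 0) (vK f.[c0]).
  have [|j _ jf] := @integral_of_values _ f i0 (leqnn _); last by exists j.
  by move=> j /fcE->.
have fc0 : f.[c0] != 0.
  by rewrite -(val_eq_infty vK); case: (vK _) val_lt0.
have unit j : gam i0 <= gam j -> vK (f.[c0]^-1 *: f).[c j] = fin 0.
  move=> ij; rewrite hornerE mulrC; apply/eqP.
  have fcj : f.[c j] != 0 by rewrite -(val_eq_infty vK) fcE // val_eq_infty.
  rewrite eq_le [X in _ && X]val_div_ge0 // fcE // lexx andbT.
  by rewrite leNgt val_div_gt0 // fcE // ltxx.
have [|j ij jf] := @integral_of_values _ (f.[c0]^-1 *: f) i0 (leqnn _).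
  by move=> j /unit->.
have := horner_unit jf (fun k jk => unit k (le_trans ij jk)).
rewrite map_polyZ hornerZ /= -in_algE fmorphV mulrC => v0.
have: fin 0 < v (f.{eta} / in_alg L f.[c0]).
  by rewrite val_div_gt0 ?fmorph_eq0 //; apply: lt_le_trans f_ge0.
by rewrite v0 ltxx.
Qed.

End PureImmediate.

(** * Purely inertial extensions *)

Section ResidueGenerator.
Variables (k E : fieldType) (iota : {rmorphism k -> E}) (z : E) (n : nat).
Local Notation "f .{ x }" := (map_poly iota f).[x]
  (at level 2, left associativity, format "f .{ x }").
Hypothesis z_gen : forall F : {pred E}, divring_closed F ->
  (forall x, iota x \in F) -> z \in F -> forall y, y \in F.

(** [mu] plays the role of the minimal polynomial of [z].  A polynomial not
    vanishing at [z] is prime to it, as a common factor would leave a smaller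
    polynomial vanishing at [z]; Bezout then shows that the values at [z] of
    polynomials form a field. *)
Lemma generator_poly (mu : {poly k}) : mu != 0 -> mu.{z} = 0 ->
    (forall q, q != 0 -> q.{z} = 0 -> (size mu <= size q)%N) ->
  forall y, exists2 p : {poly k}, (size p < size mu)%N & y = p.{z}.
Proof.
move=> mu0 muz mu_min.
pose F : {pred E} := fun y => `[< exists p : {poly k}, y = p.{z} >].
have FP y : reflect (exists p : {poly k}, y = p.{z}) (y \in F).
  exact: asboolP.
have FV y : y \in F -> y^-1 \in F.
  move=> /FP[p yE]; have [->|y0] := eqVneq y 0.
    by rewrite invr0; apply/FP; exists 0; rewrite rmorph0 horner0.
  have cop : coprimep p mu.
    have /dvdpP[q muE] := dvdp_gcdr p mu; have /dvdpP[s pE] := dvdp_gcdl p mu.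
    have hz : (gcdp p mu).{z} != 0.
      by apply: contraNneq y0 => h0; rewrite yE pE rmorphM hornerM /= h0 mulr0.
    have q0 : q != 0 by apply: contraNneq mu0 => q0; rewrite muE q0 mul0r.
    have qz : q.{z} = 0.
      move: muz; rewrite {1}muE rmorphM hornerM /= => /eqP.
      by rewrite mulf_eq0 (negPf hz) orbF => /eqP.
    have h0 : gcdp p mu != 0.
      by apply: contraNneq hz => ->; rewrite rmorph0 horner0.
    have := mu_min q q0 qz; rewrite /coprimep {1}muE size_mul //.
    rewrite -(size_poly_gt0 q) in q0; rewrite -size_poly_gt0 in h0.
    move: (size q) (size (gcdp p mu)) q0 h0 => [//|a] [//|[//|b]] _ _.
    by rewrite addSn /= !addnS ltnS ltnNge leq_addr.
  have [[u1 u2] /= bez] := Bezout_eq1_coprimepP _ _ cop.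
  apply/FP; exists u1; apply: (mulIf y0); rewrite mulVf // yE.
  have := congr1 (fun f : {poly k} => f.{z}) bez.
  rewrite rmorph1 hornerC rmorphD hornerD !rmorphM !hornerM /= muz.
  by rewrite mulr0 addr0.
have F_closed : divring_closed F.
  split=> [|x y /FP[p ->] /FP[q ->]|x y xF yF].
  - by apply/FP; exists 1; rewrite rmorph1 hornerC.
  - by apply/FP; exists (p - q); rewrite rmorphB hornerD hornerN.
  - have /FP[p ->] := xF; have /FP[q ->] := FV y yF.
    by apply/FP; exists (p * q); rewrite rmorphM hornerM.
move=> y; have /FP[p ->] : y \in F.
  apply: z_gen => // [x|]; apply/FP; last first.
    by exists 'X; rewrite map_polyX hornerX.
  by exists x%:P; rewrite map_polyC hornerC.
exists (p %% mu); first by rewrite ltn_modp.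
by rewrite {1}(divp_eq p mu) rmorphD rmorphM hornerD hornerM /= muz mulr0 add0r.
Qed.

Lemma dim_le_generators m (b : 'I_m -> restr iota) :
    Vector.axiom n (restr iota) ->
    (forall y : restr iota, exists a : 'I_m -> k, y = \sum_i a i *: b i) ->
  (n <= m)%N.
Proof.
case=> v2r lin [r2v v2rK r2vK] spans.
have v2r0 : v2r 0 = 0.
  by have := lin (-1) 0 0; rewrite scaler0 addr0 scaleN1r addNr.
have v2rD x y : v2r (x + y) = v2r x + v2r y.
  by have := lin 1 x y; rewrite !scale1r.
have v2rZ a x : v2r (a *: x) = a *: v2r x.
  by have := lin a x 0; rewrite v2r0 !addr0.
pose M := \matrix_(i < m) v2r (b i).
have full : (1%:M <= M)%MS.
  apply/row_subP => i; have [a aE] := spans (r2v (row i 1%:M)).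
  apply/submxP; exists (\row_j a j); rewrite mulmx_sum_row -[LHS]r2vK aE.
  rewrite (big_morph v2r v2rD v2r0); apply: eq_bigr => j _.
  by rewrite v2rZ mxE rowK.
have := mxrankS full; rewrite mxrank1 => /leq_trans; apply.
exact: rank_leq_row.
Qed.

(** A relation of size at most [n] would let fewer than [n] powers of [z] span
    the [n]-dimensional space [E]. *)
Lemma generator_independent (q : {poly k}) : Vector.axiom n (restr iota) ->
  (size q <= n)%N -> q.{z} = 0 -> q = 0.
Proof.
move=> dimE qn qz; apply/eqP; apply: contraT => q0.
pose ann s := `[< exists f : {poly k}, [/\ f != 0, f.{z} = 0 & size f = s] >].
have ann_q : exists s, ann s by exists (size q); apply/asboolP; exists q.
case: (ex_minnP ann_q) => s /asboolP[mu [mu0 muz <-]] mu_min.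
have {}mu_min f : f != 0 -> f.{z} = 0 -> (size mu <= size f)%N.
  by move=> f0 fz; apply: mu_min; apply/asboolP; exists f.
have span := generator_poly mu0 muz mu_min.
have : (n <= (size mu).-1)%N.
  apply: (@dim_le_generators _ (fun i => z ^+ i)) => // y.
  have [p pmu ->] := span y; exists (fun i => p`_i).
  rewrite (@horner_coef_wide _ (size mu).-1); last first.
    by rewrite size_map_poly -ltnS prednK ?size_poly_gt0.
  by apply: eq_bigr => i _; rewrite coef_map.
rewrite leqNgt -ltnS prednK ?size_poly_gt0 // ltnS.
by rewrite (leq_trans (mu_min q q0 qz)).
Qed.

End ResidueGenerator.

Section PurelyInertial.
Variables (K : fieldType) (L : fieldExtType K) (G : orderedAbelianType).
Variables (v : valuation L G) (eta : L).
Local Notation vK := (restrict v).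
Local Notation "f .{ x }" := (map_poly (in_alg L) f).[x]
  (at level 2, left associativity, format "f .{ x }").
Hypothesis inertial : purely_inertial_in v eta.

(** After division by a coefficient [r] of least value, the residue of [f (eta)]
    is a nontrivial combination of independent powers of the residue of
    [eta]. *)
Lemma inertial_val (f : {poly K}) : (size f <= \dim {:L})%N -> f != 0 ->
  exists r : K, [/\ r != 0, v f.{eta} = v r%:A & forall i, vK r <= vK f`_i].
Proof.
move=> fn f0; have [[_ [dimE]] [x xE x_gen]] := inertial.
have [r [P [r0 fE P0 rmin _]]] := primitive_part vK f0; exists r; split=> //.
have v_unit : v (map_poly (valring_val vK) P).{eta} = fin 0.
  rewrite -xE; apply/eqP; rewrite -(val_horner P x) -residue_neq0.
  rewrite residue_horner; apply: contraNneq P0 => Pz; apply/eqP.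
  apply: (generator_independent x_gen dimE _ Pz); apply: leq_trans fn.
  rewrite (leq_trans (size_poly _ _)) // fE size_scale //.
  by rewrite (size_map_inj_poly (@val_inj _ _ _)) // rmorph0.
rewrite fE map_polyZ hornerZ /= val_mul v_unit -[_%:A]/(in_alg L r).
have : in_alg L r != 0 by rewrite fmorph_eq0.
by move/(val_finite v)=> [t ->]; rewrite /= addr0.
Qed.

Lemma inertial_level (x : L) : <<1; eta>>%VS = fullv -> x != 0 ->
  exists2 d : K, d != 0 & v x = v d%:A.
Proof.
move=> gen; have [f fn ->] := small_poly_repr gen x => fx.
have [|r [r0 fr _]] := inertial_val fn; last by exists r.
by apply: contraNneq fx => ->; rewrite rmorph0 horner0.
Qed.

(** [f] itself has integral coefficients by [inertial_val].  As [eta] is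
    integral and [v (eta - c) >= v eta], so are [c] and [d], hence the
    substitution. *)
Lemma inertial_integral (x : L) (c d : K) : <<1; eta>>%VS = fullv ->
    v (eta - c%:A) = v d%:A -> v eta <= v (eta - c%:A) -> fin 0 <= v x ->
  exists2 f : {poly K}, x = f.{eta} & integral_at vK c d f.
Proof.
move=> gen vd ec x0; have [f fn xE] := small_poly_repr gen x.
have [_ [e eE _]] := inertial.
have eta0 : fin 0 <= v eta by rewrite -eE; exact: (valP e).
exists f => //; apply: polyOver_comp.
  have [->|f0] := eqVneq f 0; first by rewrite rpred0.
  have [r [_ fr rmin]] := inertial_val fn f0.
  apply/polyOverP => i; apply: le_trans (rmin i).
  by rewrite /restrict /= /restrict_fun -fr -xE.
rewrite /affine rpredD //.
  apply/polyOverP => i; rewrite coefZ coefX mulr_natr rpredMn //.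
  by rewrite inE /restrict /= /restrict_fun -vd (le_trans eta0).
rewrite polyOverC inE /restrict /= /restrict_fun -[X in v X](subKr eta).
by apply: val_subring_ge => //; apply: le_trans ec.
Qed.

End PurelyInertial.

(** * The isomorphism *)

Section Levels.
Variables (K : fieldType) (L : fieldExtType K) (G : orderedAbelianType).
Variables (v : valuation L G) (eta : L) (I : Type) (c : I -> K).
Hypothesis eta_gen : <<1; eta>>%VS = fullv.
Hypothesis cofinal : forall a : K,
  exists i, v (eta - a%:A) <= v (eta - (c i)%:A).
Hypothesis eta_c : forall i, eta - (c i)%:A != 0.

Lemma pure_immediate_levels : pure_immediate v eta ->
  exists d : I -> K, exhausting_levels v eta c d.
Proof.
move=> [_ imm eta_pure].
have /choice[d dP] : forall i, exists d : K,
    d != 0 /\ v (eta - (c i)%:A) = v d%:A.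
  by move=> i; have [d] := immediate_level imm (eta_c i); exists d.
(* Approximating [eta - c i] by [a] gives the better centre [c i + a]. *)
have no_max i : exists j, v (eta - (c i)%:A) < v (eta - (c j)%:A).
  have [a lt_a] := immediate_approx imm (eta_c i).
  have [j le_j] := cofinal (c i + a); exists j; apply: lt_le_trans le_j.
  by rewrite scalerDl opprD addrA.
exists d; split=> [i|i|x x0]; try by case: (dP i).
have [f fn xE] := small_poly_repr eta_gen x; have [c0 fc0] := eta_pure f fn.
have [i0 ci0] := cofinal c0.
have [|i fi] := pure_integral (fun i => (dP i).1) (fun i => (dP i).2)
                  no_max fc0 ci0; first by rewrite -xE.
by exists i, f.
Qed.

Lemma purely_inertial_levels : purely_inertial_in v eta ->
  exists d : I -> K, exhausting_levels v eta c d.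
Proof.
move=> inert.
have /choice[d dP] : forall i, exists d : K,
    d != 0 /\ v (eta - (c i)%:A) = v d%:A.
  by move=> i; have [d] := inertial_level inert eta_gen (eta_c i); exists d.
exists d; split=> [i|i|x x0]; try by case: (dP i).
have [i0] := cofinal 0; rewrite scale0r subr0 => le_i0.
have [f xE f_int] := inertial_integral inert eta_gen (dP i0).2 le_i0 x0.
by exists i0, f.
Qed.

End Levels.

Theorem theorem5p10 (K : fieldType) (L : fieldExtType K)
    (Gamma : orderedAbelianType) (v : valuation L Gamma)
    (v_onto : value_group v = setT)
    (eta : L) (eta_gen : <<1; eta>>%VS = fullv)
    (eta_ext : [\/ pure_defect v eta, branched_pure v eta
                 | purely_inertial_in v eta])
    (g : {poly K}) (g_min : map_poly (in_alg L) g = minPoly 1%AS eta)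
    (I : Type) (c : I -> K) (Q : I -> {poly K})
    (QE : forall i, Q i = 'X - (c i)%:P)
    (Q_fin : forall i, nu v eta (Q i) < infty)
    (c_cofinal : cofinal_in (range (fun i => v (eta - (c i)%:A)))
                            (range (fun a : K => v (eta - a%:A)))) :
  let alpha_ i := sub_infty (nu v eta (Q i)^`()) (nu v eta (Q i)) in
  let beta_ i := sub_infty (nu v eta g^`()) (nu_trunc v eta (Q i) g) in
  let alpha := final_closure (range alpha_) in
  let beta := final_closure (range beta_) in
  exists A B : submodClosed (restr (valring_val v)),
    [/\ forall b : L, (b \in A) <-> IS v alpha b,
        forall b : L, (b \in B) <-> IS v beta b,
        {subset B <= A} &
        lmod_isomorphic (kaehler (valring_map v)) (subquot A B)].
Proof.
have cofinal (a : K) : exists i, v (eta - a%:A) <= v (eta - (c i)%:A).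
  have [|_ [i _ <-] ai] := c_cofinal.2 (v (eta - a%:A)); first by exists a.
  by exists i.
have eta_c i : eta - (c i)%:A != 0.
  rewrite -(val_eq_infty v); have := Q_fin i; rewrite lt_neqAle => /andP[+ _].
  by rewrite -[nu _ _ _]/(v _.[_]) QE rmorphB /= map_polyX map_polyC !hornerE.
have [d levels] : exists d : I -> K, exhausting_levels v eta c d.
  case: eta_ext => [[pure _]|[pure _]|inert].
  - exact: pure_immediate_levels cofinal eta_c pure.
  - exact: pure_immediate_levels cofinal eta_c pure.
  - exact: purely_inertial_levels cofinal eta_c inert.
exact: (kaehler_of_levels (minPoly_neq0 g_min) (minPoly_root g_min)
          (minPoly_dvd g_min) levels).
Qed.
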